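(* The following are equivalent for a separable completely metrisable space $X$: (1) $(X\to\{\bullet\})\in\{\mathsf M\to\mathsf\Lambda,\ \mathsf\Lambda\to\{\bullet\}\}^{lr}$; (2) $X$ is a retract of $\mathbb R^{\omega}$. Furthermore, if $X$ is also an absolute neighbourhood retract for separable metric spaces, conditions (1) and (2) are also equivalent to each of the following: (3) $X$ is contractible; (4) $X$ is homotopically trivial; (5) $X$ is an absolute retract for separable metric spaces; (6) $X$ is an absolute extensor for separable metric spaces.
   Context: The class in (1) is computed in the category of all topological spaces and continuous maps. $\{\bullet\}$ is the one-point space. $\mathsf\Lambda=\{a\leftarrow o\to b\}$ is the three-point space with one open point $o$ and two closed points $a,b$ (open sets $\emptyset,\{o\},\{a,o\},\{o,b\},\{a,o,b\}$). $\mathsf M=\{a\leftarrow u\to x\leftarrow v\to b\}$ is the five-point space whose topology is generated by the open sets $\{u\},\{v\},\{a,u\},\{u,x,v\},\{v,b\}$. The map $\mathsf M\to\mathsf\Lambda$ sends $a\mapsto a$, $b\mapsto b$ and $u,x,v\mapsto o$. For maps $f:A\to B$, $g:X\to Y$, $f\pitchfork g$ means: for all $t:A\to X$, $s:B\to Y$ with $g\circ t=s\circ f$ there is $h:B\to X$ with $h\circ f=t$ and $g\circ h=s$. For a class $P$ of maps, $P^l=\{f:\ f\pitchfork g \text{ for all } g\in P\}$, $P^r=\{g:\ f\pitchfork g\text{ for all } f\in P\}$, $P^{lr}=(P^l)^r$. $\mathbb R^\omega$ is the countable product of real lines. Homotopically trivial means non-empty with every map $\mathbb S^n\to X$, $n\ge0$,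 extending to $\mathbb D^{n+1}$. $X$ is an absolute (neighbourhood) retract for separable metric spaces if whenever $X$ is embedded as a closed subspace of a separable metrisable space $Z$, it is a retract of $Z$ (of a neighbourhood of $X$ in $Z$); $X$ is an absolute extensor for separable metric spaces if every continuous map to $X$ from a closed subspace of a separable metrisable space $Z$ extends continuously to $Z$. *)

(* Defs.v *)
From HB Require Import structures.
From mathcomp Require Import all_boot all_order all_algebra finmap.
From mathcomp Require Import all_classical all_reals all_analysis.
Import Order.TTheory GRing.Theory Num.Theory.
Import numFieldNormedType.Exports.

Set Implicit Arguments.
Unset Strict Implicit.
Unset Printing Implicit Defensive.

Local Open Scope classical_set_scope.
Local Open Scope ring_scope.

Definition lifts {A B X Y : topologicalType} (f : A -> B) (g : X -> Y) : Prop :=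
  forall (t : A -> X) (s : B -> Y), continuous t -> continuous s ->
    g \o t = s \o f ->
    exists h : B -> X, [/\ continuous h, h \o f = t & g \o h = s].

Definition map_class := forall X Y : topologicalType, (X -> Y) -> Prop.

Definition left_orth (P : map_class) : map_class := fun A B f =>
  continuous f /\
  forall (X Y : topologicalType) (g : X -> Y), P X Y g -> lifts f g.

Definition right_orth (P : map_class) : map_class := fun X Y g =>
  continuous g /\
  forall (A B : topologicalType) (f : A -> B), P A B f -> lifts f g.

HB.instance Definition _ :=
  @isOpenTopological.Build unit [set: set unit]
    I (fun _ _ _ _ => I) (fun _ _ _ => I).

Variant Lambda_space := La | Lo | Lb.

HB.instance Definition _ := gen_eqMixin Lambda_space.
HB.instance Definition _ := gen_choiceMixin Lambda_space.

Definition Lambda_open : set_system Lambda_space :=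
  [set set0; [set Lo]; [set La; Lo]; [set Lo; Lb]; [set La; Lo; Lb]].

Lemma Lambda_openP (U : set Lambda_space) :
  Lambda_open U <-> (U La -> U Lo) /\ (U Lb -> U Lo).
Proof.
split.
  move=> [[[[->|->]|->]|->]|->]; split => //=; tauto.
move=> [ao bo]; have E V : (U La <-> V La) -> (U Lo <-> V Lo) ->
    (U Lb <-> V Lb) -> U = V.
  by move=> *; apply/seteqP; split => -[]; tauto.
have [Uo|nUo] := pselect (U Lo); last first.
  by do 4 left; apply: E; split => //=; tauto.
have [Ua|nUa] := pselect (U La); have [Ub|nUb] := pselect (U Lb).
- by right; apply: E; rewrite /=; tauto.
- by left; left; right; apply: E; rewrite /=; split => //; try tauto;
    move=> -[].
- by left; right; apply: E; rewrite /=; split => //; try tauto; move=> -[].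
- by do 3 left; right; apply: E; rewrite /=; split => //; tauto.
Qed.

Lemma Lambda_openT : Lambda_open setT.
Proof. exact/Lambda_openP. Qed.

Lemma Lambda_openI : setI_closed Lambda_open.
Proof.
move=> U V /Lambda_openP[Ua Ub] /Lambda_openP[Va Vb]; apply/Lambda_openP.
by split => -[]; split; tauto.
Qed.

Lemma Lambda_open_bigU (I : Type) (U : I -> set Lambda_space) :
  (forall i, Lambda_open (U i)) -> Lambda_open (\bigcup_i U i).
Proof.
move=> oU; apply/Lambda_openP.
by split => -[i _ Ui]; exists i => //; have /Lambda_openP[] := oU i; tauto.
Qed.

HB.instance Definition _ := isOpenTopological.Build Lambda_space
  Lambda_openT Lambda_openI Lambda_open_bigU.

Variant M_space := Ma | Mu | Mx | Mv | Mb.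

HB.instance Definition _ := gen_eqMixin M_space.
HB.instance Definition _ := gen_choiceMixin M_space.

Definition M_subbase : set_system M_space :=
  [set [set Mu]; [set Mv]; [set Ma; Mu]; [set Mu; Mx; Mv]; [set Mv; Mb]].

HB.instance Definition _ :=
  @isSubBaseTopological.Build M_space (set M_space) M_subbase id.

Definition M_to_Lambda (p : M_space) : Lambda_space :=
  match p with Ma => La | Mb => Lb | Mu | Mx | Mv => Lo end.

Lemma M_subbase_open (U : set M_space) : M_subbase U -> open U.
Proof.
move=> sU; exists [set U]; last by rewrite bigcup_set1.
move=> _ ->; exists [fset U]%fset; last first.
  by rewrite set_fset1 bigcap_set1.
by move=> V /fset1P ->; rewrite inE.
Qed.

Lemma M_to_Lambda_continuous : continuous M_to_Lambda.
Proof.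
have oU U : M_subbase U -> open U := @M_subbase_open U.
apply/continuousP => U; rewrite -[open U]/(Lambda_open U) => oLU.
have o1 : open [set Mu; Mx; Mv] by apply: oU; left; right.
have o2 : open [set Ma; Mu] by apply: oU; left; left; right.
have o3 : open [set Mv; Mb] by apply: oU; right.
have E V W : (forall p, V p <-> W p) -> open W -> open (V : set M_space).
  by move=> VW; have -> : V = W by apply/seteqP; split => p /VW.
case: oLU => [[[[->|->]|->]|->]|->].
- by rewrite preimage_set0; exact: open0.
- by apply: E o1 => -[] /=; intuition congruence.
- by apply: E (openU o1 o2) => -[] /=; intuition congruence.
- by apply: E (openU o1 o3) => -[] /=; intuition congruence.
- by apply: E (openU o1 (openU o2 o3)) => -[] /=; intuition congruence.
Qed.

Definition to_point (X : Type) (_ : X) : unit := tt.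
Arguments to_point X _ : clear implicits.

Variant gen_maps : map_class :=
| gen_M_Lambda : gen_maps M_to_Lambda
| gen_Lambda_point : gen_maps (to_point Lambda_space).

Definition separable_space (T : topologicalType) : Prop :=
  exists2 D : set T, countable D & dense D.

Definition homeomorphic (S T : topologicalType) : Prop :=
  exists (f : S -> T) (g : T -> S),
    [/\ continuous f, continuous g, cancel f g & cancel g f].

Definition metrisable (R : realType) (T : topologicalType) : Prop :=
  exists M : metricType R, homeomorphic T M.

Definition completely_metrisable (R : realType) (T : topologicalType) : Prop :=
  exists M : metricType R, homeomorphic T M /\
    forall u : nat -> M, cauchy (u @ \oo) -> exists l : M, u @ \oo --> l.

(** [X] is homeomorphic to a retract of [Y]: [cancel s r] makes [s] an embedding
    and [s \o r] a retraction of [Y] onto the image of [s]. *)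
Definition is_retract_of (X Y : topologicalType) : Prop :=
  exists (s : X -> Y) (r : Y -> X),
    [/\ continuous s, continuous r & cancel s r].

Definition closed_embedding (X Z : topologicalType) (i : X -> Z) : Prop :=
  [/\ injective i,
      @open X = [set i @^-1` V | V in @open Z] &
      closed (range i)].

Definition absolute_retract (R : realType) (X : topologicalType) : Prop :=
  forall (Z : topologicalType) (i : X -> Z),
    separable_space Z -> metrisable R Z -> closed_embedding i ->
    exists r : Z -> X, continuous r /\ cancel i r.

(** The retraction is a map out of the subspace [U] rather than a total map out
    of [Z], so that the empty [X] (with [U] empty) is not excluded. *)
Definition absolute_neighbourhood_retract (R : realType) (X : topologicalType)
    : Prop :=
  forall (Z : topologicalType) (i : X -> Z),
    separable_space Z -> metrisable R Z -> closed_embedding i ->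
    exists2 U : set Z, range i `<=` interior U &
      exists r : U -> X, continuous r /\
        forall (x : X) (z : U), set_val z = i x -> r z = x.

Definition absolute_extensor (R : realType) (X : topologicalType) : Prop :=
  forall (Z : topologicalType) (A : set Z) (f : A -> X),
    separable_space Z -> metrisable R Z -> closed A -> continuous f ->
    exists g : Z -> X, continuous g /\ g \o set_val = f.

Definition contractible (R : realType) (X : topologicalType) : Prop :=
  exists (x0 : X) (H : X * R -> X),
    [/\ {within [set: X] `*` `[0, 1], continuous H},
        forall x, H (x, 0) = x &
        forall x, H (x, 1) = x0].

(** The norm of ['rV[R]_n] is the sup norm, whence the explicit sum of
    squares; its topology is the usual one. *)
Definition sphere (R : realType) (n : nat) : set 'rV[R]_n.+1 :=
  [set v : 'rV[R]_n.+1 | \sum_i v ord0 i ^+ 2 = 1].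
Arguments sphere R n : clear implicits.

Definition disk (R : realType) (n : nat) : set 'rV[R]_n :=
  [set v : 'rV[R]_n | \sum_i v ord0 i ^+ 2 <= 1].
Arguments disk R n : clear implicits.

Definition homotopically_trivial (R : realType) (X : topologicalType) : Prop :=
  [set: X] !=set0 /\
  forall (n : nat) (f : sphere R n -> X), continuous f ->
    exists g : disk R n.+1 -> X, continuous g /\
      forall (s : sphere R n) (d : disk R n.+1),
        set_val s = set_val d -> g d = f s.

Definition R_omega (R : realType) : topologicalType := {ptws nat -> R}.

(* Main.v *)
Require Import Defs.
From HB Require Import structures.
From mathcomp Require Import all_boot all_order all_algebra.
From mathcomp Require Import all_classical all_reals all_analysis.
From mathcomp Require Import lra.
Import Order.TTheory GRing.Theory Num.Theory.
Import numFieldNormedType.Exports.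

Set Implicit Arguments.
Unset Strict Implicit.
Unset Printing Implicit Defensive.

Local Open Scope classical_set_scope.
Local Open Scope ring_scope.

(**
A map lifting against [M -> Lambda] extends pairs of disjoint open sets that
separate prescribed closed sets; this is all that the proofs of Urysohn's
lemma and of Tietze's theorem use. Hence the real line, its powers and their
retracts are right orthogonal to {M -> Lambda, Lambda -> point}^l. Conversely
a closed embedding into a metrisable space lies in {M -> Lambda, Lambda ->
point}^l, and a separable completely metrisable X embeds as a closed subspace
of R^omega, so that lifting the identity of X along this embedding gives a
retraction.

The remaining point is that a homotopically trivial neighbourhood retract X of
R^omega is a retract. First, maps from compact subsets of finite-dimensional
boxes to X extend to the boxes: use the neighbourhood retraction on the cells
of a fine cubical grid meeting the compact set, and homotopical triviality on
the others, by increasing dimension. This gives maps from an increasing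
sequence of finite-dimensional boxes to X, each extending the previous one and
all equal to the neighbourhood retraction near X. The retraction sends y
outside X to the image of the truncation of y to the box of radius 1 / dist(y,
X).
*)

(** * Closed embeddings into metrisable spaces *)

Section embeddings.
Context {A B : topologicalType} {f : A -> B} (cef : closed_embedding f).

Lemma closed_embedding_continuous : continuous f.
Proof.
by case: cef => _ oE _; apply/continuousP => V oV; rewrite oE; exists V.
Qed.

Lemma closed_embedding_closed (F : set A) : closed F -> closed (f @` F).
Proof.
case: cef => fI oE fC cF; have : open (~` F) by exact: closed_openC.
rewrite oE => -[V oV VF].
have -> : f @` F = range f `&` ~` V.
  apply/seteqP; split => [_ [a Fa <-]|_ [[a _ <-] Vfa]].
    split; first by exists a.
    by move=> Vfa; have : (f @^-1` V) a by []; rewrite VF.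
  exists a => //; apply: contrapT => nFa; apply: Vfa.
  by have : (~` F) a by []; rewrite -VF.
by apply: closedI => //; exact: open_closedC.
Qed.

End embeddings.

Lemma closed_embedding_set_val (Z : topologicalType) (A : set Z) :
  closed A -> closed_embedding (set_val : A -> Z).
Proof.
move=> cA; split; [exact: val_inj|by []|].
have -> // : range (set_val : A -> Z) = A.
apply/seteqP; split => [_ [a _ <-]|a Aa]; first exact: set_valP.
by exists (exist _ a (mem_set Aa)).
Qed.

(** Every non-empty open set contains [Lo], so the complement of its preimage is a union of fibres
    over the two closed points. *)
Lemma continuous_Lambda (T : topologicalType) (h : T -> Lambda_space) :
  closed (h @^-1` [set La]) -> closed (h @^-1` [set Lb]) -> continuous h.
Proof.
move=> ca cb; apply/continuousP => U /Lambda_openP[Ua Ub].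
have [Uo|nUo] := pselect (U Lo); last first.
  rewrite (_ : _ @^-1` _ = set0); first exact: open0.
  by apply/seteqP; split => // x /=; case: (h x); tauto.
rewrite -[_ @^-1` _]setCK; apply: closed_openC.
have -> : ~` (h @^-1` U) =
    (h @^-1` [set La] `&` [set x | ~ U La]) `|`
    (h @^-1` [set Lb] `&` [set x | ~ U Lb]).
  by apply/seteqP; split => x /=; case: (h x); intuition congruence.
have cP (P : Prop) : closed [set x : T | P].
  have [p|np] := pselect P.
    rewrite (_ : mkset _ = setT); first exact: closedT.
    by apply/seteqP; split => // x _; exact: p.
  rewrite (_ : mkset _ = set0); first exact: closed0.
  by apply/seteqP; split => // x /np.
by apply: closedU; apply: closedI.
Qed.

Lemma continuous_M (T : topologicalType) (h : T -> M_space) :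
  (forall U, M_subbase U -> open (h @^-1` U)) -> continuous h.
Proof.
move=> hU; apply/continuousP => _ [F FS <-].
rewrite preimage_bigcup; apply: bigcup_open => V /FS[G GS <-].
rewrite preimage_bigcap bigcap_fset big_seq.
apply: big_ind => [|P Q|W /GS]; [exact: openT|exact: openI|].
by rewrite inE; exact: hU.
Qed.

(** Complete normality: [P] and [Q] are separated, not necessarily closed. Balls of half the
    admissible radius suffice: if two of them met, the centre with the smaller radius would lie in
    the full ball about the other one. *)
Lemma metrisable_separated (R : realType) (Z : topologicalType)
    (P Q O1 O2 : set Z) : metrisable R Z -> open O1 -> open O2 ->
  P `<=` O1 -> Q `<=` O2 -> O1 `&` Q = set0 -> O2 `&` P = set0 ->
  exists U V : set Z,
    [/\ open U, open V, P `<=` U, Q `<=` V & U `&` V = set0].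
Proof.
move=> [M [f [g [cf cg fK gK]]]] oO1 oO2 PO1 QO2 O1Q O2P.
have radius (S O : set Z) p : open O -> S p -> S `<=` O ->
    exists e : {posnum R}, forall q, mdist (f p) (f q) < e%:num -> O q.
  move=> oO Sp SO; have : nbhs (f p) (g @^-1` O).
    by apply: cg; rewrite fK; apply: open_nbhs_nbhs; split => //; exact: SO.
  rewrite -filter_from_ballE => -[e /= e0 eO]; exists (PosNum e0) => q.
  by rewrite -[X in O X]fK => pq; apply: eO; rewrite ballEmdist.
have oball p (e : {posnum R}) : open [set q | mdist (f p) (f q) < e%:num].
  rewrite openE => q /= pq.
  have e0 : 0 < e%:num - mdist (f p) (f q) by rewrite subr_gt0.
  have : nbhs (f q) (ball (f q) (e%:num - mdist (f p) (f q))).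
    exact: nbhsx_ballx.
  move/cf; rewrite /interior /nbhs /=; apply: filterS => z.
  rewrite /= ballEmdist /= ltrBrDr addrC => ?.
  by apply: le_lt_trans (metric_triangle _ (f q) _) _.
have /choice[eP HP] p : exists e : {posnum R},
    P p -> forall q, mdist (f p) (f q) < e%:num -> O1 q.
  have [Pp|nP] := pselect (P p); last by exists 1%:pos.
  by have [e] := radius _ _ _ oO1 Pp PO1; exists e.
have /choice[eQ HQ] p : exists e : {posnum R},
    Q p -> forall q, mdist (f p) (f q) < e%:num -> O2 q.
  have [Pp|nP] := pselect (Q p); last by exists 1%:pos.
  by have [e] := radius _ _ _ oO2 Pp QO2; exists e.
exists (\bigcup_(p in P) [set q | mdist (f p) (f q) < ((eP p)%:num /
  2)%:pos%:num]).
exists (\bigcup_(p in Q) [set q | mdist (f p) (f q) < ((eQ p)%:num /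
  2)%:pos%:num]).
split.
- by apply: bigcup_open => p _; exact: oball.
- by apply: bigcup_open => p _; exact: oball.
- by move=> p Pp; exists p => //=; rewrite mdistxx.
- by move=> p Pp; exists p => //=; rewrite mdistxx.
- apply/seteqP; split => // z [[p Pp /= pz] [q Qq /= qz]].
  have pq : mdist (f p) (f q) < (eP p)%:num / 2 + (eQ q)%:num / 2.
    apply: le_lt_trans (metric_triangle _ (f z) _) _.
    by rewrite ltrD // metric_sym.
  have [le|lt] := leP (eP p)%:num (eQ q)%:num.
    have : (O2 `&` P) p; last by rewrite O2P.
    split => //; apply: (HQ q) => //; rewrite metric_sym;
      apply: lt_le_trans pq _.
    lra.
  have : (O1 `&` Q) q; last by rewrite O1Q.
  split => //; apply: (HP p) => //; apply: lt_trans pq _; lra.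
Qed.

(** A lift to [M_space] is prescribed on the image of [f] and wherever [s] is [La] or [Lb].
    Elsewhere the choice between [Mu], [Mv] and [Mx] is made by disjoint open sets separating the
    points bound to [[set Ma; Mu]] from those bound to [[set Mv; Mb]]. *)
Lemma closed_embedding_left_orth (R : realType) (A Z : topologicalType)
    (f : A -> Z) : metrisable R Z -> closed_embedding f ->
  left_orth gen_maps f.
Proof.
move=> mZ cef; split; first exact: closed_embedding_continuous cef.
have [fI _ fC] := cef; have fcl := closed_embedding_closed cef.
pose ext (Y : Type) (t : A -> Y) (u : Z -> Y) z :=
  if pselect (exists a, f a = z) is left e then t (projT1 (cid e)) else u z.
have extE (Y : Type) (t : A -> Y) (u : Z -> Y) a : ext Y t u (f a) = t a.
  rewrite /ext; case: pselect => [e|[]]; last by exists a.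
  by congr t; apply: fI; exact: (projT2 (cid e)).
have extN (Y : Type) (t : A -> Y) (u : Z -> Y) z :
    ~ range f z -> ext Y t u z = u z.
  move=> nz; rewrite /ext; case: pselect => // -[a ea].
  by exfalso; apply: nz; exists a.
move=> X Y g []; move=> t s ct cs ts.
- have tE a : s (f a) = M_to_Lambda (t a) by have := congr1 (@^~ a) ts.
  have cpreT S : open S -> closed (f @` (t @^-1` (~` S))).
    move=> oS; apply: fcl; apply: closed_comp; first by move=> ? _; exact: ct.
    exact: open_closedC.
  have clL l : l <> Lo -> closed (s @^-1` [set l]).
    move=> lo; apply: closed_comp; first by move=> ? _; exact: cs.
    rewrite -[[set l]]setCK; apply: open_closedC; apply/Lambda_openP.
    by case: l lo => //= _; split=> //; congruence.
  have oL S : Lambda_open S -> open (s @^-1` S).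
    by move=> oS; move/continuousP : cs; exact.
  have oau : open [set Ma; Mu] by apply: M_subbase_open; left; left; right.
  have ovb : open [set Mv; Mb] by apply: M_subbase_open; right.
  (* [P] collects the points forced into [[set Ma; Mu]], and [O1] is the complement of those forced
     out of it. [P] need not be closed, because [[set Ma; Mu]] is not; [O1] is open because [f] is a
     closed map. *)
  pose P := f @` (t @^-1` [set Ma; Mu]) `|` s @^-1` [set La].
  pose Q := f @` (t @^-1` [set Mv; Mb]) `|` s @^-1` [set Lb].
  pose O1 := ~` (f @` (t @^-1` (~` [set Ma; Mu])) `|` s @^-1` [set Lb]).
  pose O2 := ~` (f @` (t @^-1` (~` [set Mv; Mb])) `|` s @^-1` [set La]).
  have [||||||U [V [oU oV PU QV UV]]] := @metrisable_separated R Z P Q O1 O2 mZ.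
  + by apply: closed_openC; apply: closedU; [exact: cpreT|exact: clL].
  + by apply: closed_openC; apply: closedU; [exact: cpreT|exact: clL].
  + move=> z Pz; rewrite /O1; case: Pz => [[a /= ta <-]|/= sz].
      rewrite /setC /= tE => -[[b /= tb /fI ba]|]; first by subst b; exact: tb.
      by case: ta => ->.
    move=> [[a /= ta az]|]/=; last by rewrite sz.
    by move: sz; rewrite -az tE; case: (t a) ta => //=; tauto.
  + move=> z Pz; rewrite /O2; case: Pz => [[a /= ta <-]|/= sz].
      rewrite /setC /= tE => -[[b /= tb /fI ba]|]; first by subst b; exact: tb.
      by case: ta => ->.
    move=> [[a /= ta az]|]/=; last by rewrite sz.
    by move: sz; rewrite -az tE; case: (t a) ta => //=; tauto.
  + apply/seteqP; split => // z [+ Qz]; apply; case: Qz => [[a ta <-]|];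
      last by right.
    by left; exists a => //= -[]; case: ta => -> //.
  + apply/seteqP; split => // z [+ Qz]; apply; case: Qz => [[a ta <-]|];
      last by right.
    by left; exists a => //= -[]; case: ta => -> //.
  pose u z := match s z with La => Ma | Lb => Mb | Lo =>
    if z \in U then Mu else if z \in V then Mv else Mx end.
  exists (ext _ t u); split; last 2 first.
  + by apply/funext => a; exact: extE.
  + apply/funext => z /=; have [[a _ <-]|nz] := pselect (range f z).
      by rewrite extE tE.
    by rewrite extN // /u; case: (s z) => //; do 2?case: ifP.
  (* [W] may contain too much of the image of [f]; removing the closed set of image points with
     [t]-value outside [S] corrects this. *)
  have key S W : open S -> open W -> (forall a, S (t a) -> W (f a)) ->
      (forall z, ~ range f z -> W z <-> S (u z)) -> open (ext _ t u @^-1` S).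
    move=> oS oW W1 W2.
    have -> : ext _ t u @^-1` S = W `&` ~` (f @` (t @^-1` (~` S))).
      apply/seteqP; split => z /=.
        have [[a _ <-]|nz] := pselect (range f z).
          rewrite extE => Sa; split; first exact: W1.
          by move=> [b /= nS /fI ba]; subst b.
        rewrite extN // => /(W2 _ nz) Wz; split => // -[a _ az].
        by apply: nz; exists a.
      have [[a _ <-]|nz] := pselect (range f z); last first.
        by rewrite extN // => -[/(W2 _ nz)].
      rewrite extE => -[_ h]; apply: contrapT => nS; apply: h.
      by exists a.
    by apply: openI => //; apply: closed_openC; exact: cpreT.
  have PUa a : t a = Ma \/ t a = Mu -> U (f a).
    by move=> ta; apply: PU; left; exists a.
  have QVa a : t a = Mv \/ t a = Mb -> V (f a).
    by move=> ta; apply: QV; left; exists a.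
  have nUV z : U z -> V z -> False.
    by move=> Uz Vz; have : (U `&` V) z by []; rewrite UV.
  have PUs z : s z = La -> U z by move=> sz; apply: PU; right.
  have QVs z : s z = Lb -> V z by move=> sz; apply: QV; right.
  have uP z : ([/\ s z = La, U z, ~ V z & u z = Ma] \/
    [/\ s z = Lb, ~ U z, V z & u z = Mb]) \/
    [/\ s z = Lo, U z, ~ V z & u z = Mu] \/
    [/\ s z = Lo, ~ U z, V z & u z = Mv] \/
    [/\ s z = Lo, ~ U z, ~ V z & u z = Mx].
    rewrite /u; case sE: (s z).
    + by left; left; split => // [|/nUV]; [|apply]; exact: PUs.
    + right; case: ifPn => [/set_mem Uz|/negP zU].
        by left; split => // /nUV; exact.
      have nU : ~ U z by move=> /mem_set.
      case: ifPn => [/set_mem Vz|/negP zV]; first by right; left.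
      by right; right; split => // /mem_set.
    + by left; right; split => // [/nUV|]; [apply|]; exact: QVs.
  have sL a : s (f a) = M_to_Lambda (t a) by exact: tE.
  apply: continuous_M => S sS; have oS := M_subbase_open sS.
  have LP S' : (S' La -> S' Lo) -> (S' Lb -> S' Lo) -> open (s @^-1` S').
    by move=> ? ?; apply: oL; apply/Lambda_openP.
  case: sS => [[[[|]|]|]|] /= SE; subst S.
  + apply: (key _ (U `&` s @^-1` [set Lo])) => //.
    * by apply: openI => //; apply: LP => //=.
    * by move=> a /= ta; rewrite tE ta; split => //; apply: PUa; right.
    * by move=> z _ /=; case: (uP z) => [[|]|[|[|]]] [sz ? ? ->]; rewrite ?sz;
        intuition discriminate.
  + apply: (key _ (V `&` s @^-1` [set Lo])) => //.
    * by apply: openI => //; apply: LP => //=.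
    * by move=> a /= ta; rewrite tE ta; split => //; apply: QVa; left.
    * by move=> z _ /=; case: (uP z) => [[|]|[|[|]]] [sz ? ? ->]; rewrite ?sz;
        intuition discriminate.
  + apply: (key _ U) => //.
    by move=> z _ /=; case: (uP z) => [[|]|[|[|]]] [sz ? ? ->]; rewrite ?sz;
      intuition discriminate.
  + apply: (key _ (s @^-1` [set Lo])) => //.
    * exact: LP.
    * by move=> a /=; rewrite tE => -[[]|] ->.
    * by move=> z _ /=; case: (uP z) => [[|]|[|[|]]] [sz ? ? ->]; rewrite ?sz;
        intuition discriminate.
  + apply: (key _ V) => //.
    by move=> z _ /=; case: (uP z) => [[|]|[|[|]]] [sz ? ? ->]; rewrite ?sz;
      intuition discriminate.
(* Against the second generator, [Lo] is a safe value off the image: the fibres over [La] and [Lb]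
   are then images under [f] of closed sets. *)
- exists (ext _ t (fun=> Lo)); split; last 2 first.
  + by apply/funext => a; exact: extE.
  + by apply/funext => z /=; case: (s z).
  have cl l : l <> Lo -> closed (ext _ t (fun=> Lo) @^-1` [set l]).
    move=> lo.
    have -> : ext _ t (fun=> Lo) @^-1` [set l] = f @` (t @^-1` [set l]).
      apply/seteqP; split => z /=; last by move=> [a ta <-]; rewrite extE.
      have [[a _ <-]|nz] := pselect (range f z).
        by rewrite extE => ta; exists a.
      by rewrite extN // => /esym.
    apply: fcl; apply: closed_comp; first by move=> ? _; exact: ct.
    rewrite -[[set l]]setCK; apply: open_closedC; apply/Lambda_openP.
    by case: l lo => //= _; split=> //; congruence.
  by apply: continuous_Lambda; apply: cl.
Qed.

(** * Extension along the maps left orthogonal to the generators *)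

Lemma continuous_R_omega (R : realType) (T : topologicalType)
    (h : T -> R_omega R) :
  (forall i, continuous (fun x => h x i)) -> continuous h.
Proof.
by move=> ch x; apply/(@pointwise_cvgP nat R) => i; exact: ch.
Qed.

Lemma R_omega_proj_continuous (R : realType) (i : nat) :
  continuous (fun y : R_omega R => y i).
Proof. exact: (@proj_continuous nat (fun=> R) i). Qed.

Section real_continuity.
Context {R : realType} {T : topologicalType}.
Implicit Types k l : T -> R.

Lemma continuous_addr k l : continuous k -> continuous l ->
  continuous (fun x => k x + l x).
Proof. by move=> ck cl x; apply: cvgD; [exact: ck|exact: cl]. Qed.

Lemma continuous_subr k l : continuous k -> continuous l ->
  continuous (fun x => k x - l x).
Proof. by move=> ck cl x; apply: cvgB; [exact: ck|exact: cl]. Qed.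

Lemma continuous_oppr k : continuous k -> continuous (fun x => - k x).
Proof. by move=> ck x; apply: cvgN; exact: ck. Qed.

Lemma continuous_mulr k l : continuous k -> continuous l ->
  continuous (fun x => k x * l x).
Proof. by move=> ck cl x; apply: cvgM; [exact: ck|exact: cl]. Qed.

Lemma continuous_norm k : continuous k -> continuous (fun x => `|k x|).
Proof. by move=> ck x; apply: cvg_norm; exact: ck. Qed.

Lemma continuous_cstr (c : R) : continuous (fun _ : T => c).
Proof. by move=> x; exact: cvg_cst. Qed.

Lemma continuous_divr k l : continuous k -> continuous l ->
  (forall x, l x != 0) -> continuous (fun x => k x / l x).
Proof.
by move=> ck cl l0 x; apply: cvgM; [exact: ck|apply: cvgV; [|exact: cl]].
Qed.

End real_continuity.

(** Dependent choice in which a new term may depend on all the earlier ones. *)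
Lemma seq_dependent_choice (T : Type) (P : seq T -> Prop) :
  P [::] -> (forall l, P l -> exists x, P (rcons l x)) ->
  exists u : nat -> T, forall n, P (mkseq u n).
Proof.
move=> P0 PS; have [x0 _] := PS _ P0.
have /choice[st stP] l : exists x, P l -> P (rcons l x).
  have [/PS[x Px]|nP] := pselect (P l); first by exists x.
  by exists x0.
pose L n := iter n (fun l => rcons l (st l)) [::].
pose u n := st (L n); exists u => n.
have LE : L n = mkseq u n.
  by elim: n => //= n IH; rewrite mkseqS -IH.
by rewrite -LE; elim: {LE} n => //= n; exact: stP.
Qed.

Section left_orth.
Context {A B : topologicalType} {f : A -> B} (Pf : left_orth gen_maps f).

(** A map to [Lambda_space] amounts to two disjoint closed sets, the fibres over [La] and [Lb]. A
    map to [M_space] above it amounts to disjoint open sets containing them, the preimages of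
    [[set Ma; Mu]] and [[set Mv; Mb]]. *)
Lemma left_orth_separation (Da Db : set B) (U V : set A) :
  closed Da -> closed Db -> Da `&` Db = set0 -> open U -> open V ->
  U `&` V = set0 -> f @^-1` Da `<=` U -> f @^-1` Db `<=` V ->
  exists U' V' : set B, [/\ open U', open V' & U' `&` V' = set0] /\
    [/\ f @^-1` U' = U, f @^-1` V' = V, Da `<=` U' & Db `<=` V'].
Proof.
have [cf lf] := Pf; move=> cDa cDb Dab oU oV UV DaU DbV.
pose t a := if f a \in Da then Ma else if f a \in Db then Mb else
  if a \in U then Mu else if a \in V then Mv else Mx.
pose s b := if b \in Da then La else if b \in Db then Lb else Lo.
have nD b : Da b -> Db b -> False.
  by move=> ab bb; have : (Da `&` Db) b by []; rewrite Dab.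
have nUV b : U b -> V b -> False.
  by move=> ab bb; have : (U `&` V) b by []; rewrite UV.
have sP b : [\/ [/\ Da b, ~ Db b & s b = La], [/\ ~ Da b, Db b & s b = Lb] |
    [/\ ~ Da b, ~ Db b & s b = Lo]].
  rewrite /s; have [/mem_set ab|ab] := pselect (Da b).
    by apply: Or31; rewrite ab; move/set_mem : ab => ab; split => // /(nD b ab).
  rewrite memNset //; have [bb|bb] := pselect (Db b).
    by apply: Or32; rewrite mem_set.
  by apply: Or33; rewrite memNset.
have tP a : [\/ [/\ Da (f a), ~ Db (f a), U a, ~ V a & t a = Ma],
    [/\ ~ Da (f a), Db (f a), ~ U a, V a & t a = Mb] |
    [/\ ~ Da (f a), ~ Db (f a) & [\/ [/\ U a, ~ V a & t a = Mu],
      [/\ ~ U a, V a & t a = Mv] | [/\ ~ U a, ~ V a & t a = Mx]]]].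
  rewrite /t; have [ab|ab] := pselect (Da (f a)).
    apply: Or31; rewrite mem_set //; split => //; first exact: nD ab.
      exact: DaU.
    by apply: nUV; exact: DaU.
  rewrite memNset //; have [bb|bb] := pselect (Db (f a)).
    apply: Or32; rewrite mem_set //; split => //; last exact: DbV.
    by move=> /nUV; apply; exact: DbV.
  apply: Or33; rewrite memNset //; split => //.
  have [ua|ua] := pselect (U a).
    by apply: Or31; rewrite mem_set //; split => // /(nUV a ua).
  rewrite memNset //; have [va|va] := pselect (V a).
    by apply: Or32; rewrite mem_set.
  by apply: Or33; rewrite memNset.
have cpre D : closed D -> open (f @^-1` (~` D)).
  by move=> cD; move/continuousP : cf; apply; exact: closed_openC.
have ct : continuous (t : A -> M_space).
  apply: continuous_M => S sS.
  case: sS => [[[[|]|]|]|] /= SE; subst S.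
  - rewrite (_ : _ @^-1` _ = U `&` f @^-1` (~` Da)).
      by apply: openI => //; exact: cpre.
    apply/seteqP; split => a /=; case: (tP a) =>
      [[? ? ? ? ->]|[? ? ? ? ->]|[? ? [] [? ? ->]]]; intuition discriminate.
  - rewrite (_ : _ @^-1` _ = V `&` f @^-1` (~` Db)).
      by apply: openI => //; exact: cpre.
    apply/seteqP; split => a /=; case: (tP a) =>
      [[? ? ? ? ->]|[? ? ? ? ->]|[? ? [] [? ? ->]]]; intuition discriminate.
  - rewrite (_ : _ @^-1` _ = U) //.
    apply/seteqP; split => a /=; case: (tP a) =>
      [[? ? ? ? ->]|[? ? ? ? ->]|[? ? [] [? ? ->]]]; intuition discriminate.
  - rewrite (_ : _ @^-1` _ = f @^-1` (~` Da) `&` f @^-1` (~` Db)).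
      by apply: openI => //; exact: cpre.
    apply/seteqP; split => a /=; case: (tP a) =>
      [[? ? ? ? ->]|[? ? ? ? ->]|[? ? [] [? ? ->]]]; intuition discriminate.
  - rewrite (_ : _ @^-1` _ = V) //.
    apply/seteqP; split => a /=; case: (tP a) =>
      [[? ? ? ? ->]|[? ? ? ? ->]|[? ? [] [? ? ->]]]; intuition discriminate.
have cs : continuous (s : B -> Lambda_space).
  apply: continuous_Lambda.
    rewrite (_ : _ @^-1` _ = Da) //; apply/seteqP; split => b /=.
      by case: (sP b) => -[? ? ->].
    by case: (sP b) => -[? ? ->].
  rewrite (_ : _ @^-1` _ = Db) //; apply/seteqP; split => b /=.
    by case: (sP b) => -[? ? ->].
  by case: (sP b) => -[? ? ->].
have [|h [ch hf sh]] := lf _ _ _ gen_M_Lambda t s ct cs.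
  apply/funext => a /=; case: (tP a) => [[aa bb _ _ ->]|[aa bb _ _ ->]|].
  - by rewrite /s mem_set.
  - by rewrite /s memNset // mem_set.
  - by case=> aa bb; rewrite /s !memNset //; case=> -[_ _ ->].
have hfE a : h (f a) = t a by rewrite -hf.
have shE b : M_to_Lambda (h b) = s b by rewrite -sh.
have oh S : open S -> open (h @^-1` S) by move/continuousP : ch; exact.
exists (h @^-1` [set Ma; Mu]), (h @^-1` [set Mv; Mb]); split; split.
- by apply: oh; apply: M_subbase_open; left; left; right.
- by apply: oh; apply: M_subbase_open; right.
- by apply/seteqP; split => // b /= [[] ->] [].
- apply/seteqP; split => a /=; rewrite hfE; case: (tP a) =>
      [[? ? ? ? ->]|[? ? ? ? ->]|[? ? [] [? ? ->]]]; intuition discriminate.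
- apply/seteqP; split => a /=; rewrite hfE; case: (tP a) =>
      [[? ? ? ? ->]|[? ? ? ? ->]|[? ? [] [? ? ->]]]; intuition discriminate.
- by move=> b Db_; move: (shE b); rewrite /s mem_set //=; case: (h b) => //;
    left.
- move=> b Db_; move: (shE b); rewrite /s memNset; last by move=> /nD; apply.
  by rewrite mem_set //=; case: (h b) => //; right.
Qed.

(* Urysohn's construction, with the sublevel sets of [h] prescribed on [A]: a
   map [B -> M_space] over [Lambda_space] is exactly a pair of disjoint open
   sets containing two given disjoint closed sets, so the lifting property of
   [f] replaces the normality of [B]. *)
Lemma left_orth_Urysohn (R : realType) (t : A -> R) (E : set B) :
  continuous t -> (forall a, 0 <= t a <= 1) -> closed E ->
  (forall a, E (f a) -> t a = 0) ->
  exists h : B -> R, [/\ continuous h, forall b, 0 <= h b <= 1,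
    forall b, E b -> h b = 0 & forall a, h (f a) = t a].
Proof.
move=> ct t01 cE Et.
have ltrq1 (q : rat) : (ratr q < 1 :> R) = (q < 1).
  by rewrite -(rmorph1 (@ratr R)) ltr_rat.
(* The thresholds run through the rationals of ]0, 1[, with default value [2^-1]. Repeated values
   are harmless, since the compatibility in [P] concerns strict inequalities. *)
pose th (n : nat) : R := if (unpickle n : option rat) is Some q then
  if 0 < q < 1 then ratr q else 2^-1 else 2^-1.
have th01 n : 0 < th n < 1.
  have h : 0 < (2^-1 : R) < 1 by apply/andP; split; lra.
  rewrite /th; case: unpickle => // q; case: ifP => // /andP[q0 q1].
  by rewrite ltr0q q0 ltrq1.
have th_dense x y : x < y -> y <= 1 -> 0 <= x -> exists n, x < th n < y.
  move=> xy y1 x0; have [q] := rat_in_itvoo xy.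
  rewrite in_itv /= => /andP[xq qy]; exists (pickle q).
  rewrite /th pickleK -(ltr0q R) -ltrq1 (le_lt_trans x0 xq).
  by rewrite (lt_le_trans qy y1) xq qy.
have ot c : open [set a | t a < c].
  by apply: (@open_comp _ _ t [set x | x < c]) => [? _|];
    [exact: ct|exact: open_lt].
have ot' c : open [set a | c < t a].
  by apply: (@open_comp _ _ t [set x | c < x]) => [? _|];
    [exact: ct|exact: open_gt].
(* [W.1] and [W.2] stand for the regions where the function to be built is below, respectively
   above, [th n]. *)
pose good n (W : set B * set B) := [/\ open W.1, open W.2 & W.1 `&` W.2 = set0]
  /\
  [/\ f @^-1` W.1 = [set a | t a < th n], f @^-1` W.2 = [set a | th n < t a]
    & E `<=` W.1].
pose d : set B * set B := (set0, set0).
(* The second clause replaces the condition in Urysohn's lemma that the closure of one level set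
   lies in the next. *)
pose P (l : seq (set B * set B)) :=
  (forall i, (i < size l)%N -> good i (nth d l i)) /\
  (forall i j, (i < size l)%N -> (j < size l)%N -> th i < th j ->
    forall b, (nth d l i).2 b \/ (nth d l j).1 b).
have [||u uP] := @seq_dependent_choice _ P.
- by split.
- move=> l [lg lc]; set n := size l.
  (* Compatibility with the earlier pairs forces [Da] into the new first component and [Db] into the
     second. Both are closed because only finitely many pairs have been chosen so far. *)
  pose Da := E `|` \bigcup_(i in [set i | (i < n)%N /\ th i < th n]) ~` (nth d
    l i).2.
  pose Db := \bigcup_(i in [set i | (i < n)%N /\ th n < th i]) ~` (nth d l i).1.
  have fin Q : finite_set [set i | (i < n)%N /\ Q i].
    by apply: (@sub_finite_set _ _ `I_n) => [i []//|]; exact: finite_II.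
  have [||||||||U [V [[oU oV UV] [fU fV DaU DbV]]]] :=
    @left_orth_separation Da Db [set a | t a < th n] [set a | th n < t a].
  + apply: closedU => //; apply: closed_bigcup => // i [il _].
    by have [[_ ? _] _] := lg _ il; exact: open_closedC.
  + apply: closed_bigcup => // i [il _].
    by have [[? _ _] _] := lg _ il; exact: open_closedC.
  + apply/seteqP; split => // b [aa [j [jl nj] jb]]; apply: jb.
    case: aa => [Eb|[i [il ni] ib]].
      by have [_ [_ _]] := lg _ jl; exact.
    by have [] := lc _ _ il jl (lt_trans ni nj) b.
  + exact: ot.
  + exact: ot'.
  + by apply/seteqP; split => // a [/= /lt_trans/[apply]]; rewrite ltxx.
  + move=> a [/= /Et ->|[i [il ni] /= ib]]; first by case/andP: (th01 n).
    have [_ [_ iV _]] := lg _ il; apply: le_lt_trans ni; rewrite leNgt.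
    by apply/negP => ti; apply: ib; have : [set a | th i < t a] a by [];
      rewrite -iV.
  + move=> a [i [il ni] /= ib]; have [_ [iU _ _]] := lg _ il.
    apply: lt_le_trans ni _; rewrite leNgt.
    by apply/negP => ti; apply: ib; have : [set a | t a < th i] a by [];
      rewrite -iU.
  exists (U, V).
  have gn : good n (U, V).
    by split; split => //= b Eb; apply: DaU; left.
  split=> [i|i j]; rewrite !size_rcons !ltnS !nth_rcons -/n.
    by rewrite leq_eqVlt; case: ltngtP => //= [/lg //|-> _]; exact: gn.
  rewrite leq_eqVlt [(j <= n)%N]leq_eqVlt.
  case: ltngtP => //= [il|->] _; case: ltngtP => //= [jl|->] _.
  + exact: lc.
  + move=> ni b; have [|] := pselect ((nth d l i).2 b); first by left.
    by move=> ib; right; apply: DaU; right; exists i.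
  + move=> nj b; have [|] := pselect ((nth d l j).1 b); first by right.
    by move=> jb; left; apply: DbV; exists j.
  + by rewrite ltxx.
have ug n : good n (u n).
  by have [+ _] := uP n.+1; move=> /(_ n);
    rewrite size_mkseq nth_mkseq // => /(_ (leqnn _)).
have uc i j : th i < th j -> forall b, (u i).2 b \/ (u j).1 b.
  have [_ +] := uP (maxn i j).+1; move=> /(_ i j); rewrite size_mkseq !ltnS.
  by rewrite leq_maxl leq_maxr !nth_mkseq ?ltnS ?leq_maxl ?leq_maxr //; apply.
have nuu n b : (u n).1 b -> (u n).2 b -> False.
  move=> b1 b2; have [[_ _ un] _] := ug n.
  by have : ((u n).1 `&` (u n).2) b by []; rewrite un.
(* The element 1 keeps the set non-empty and bounds the infimum by 1. *)
pose S b : set R := 1 |` [set th n | n in [set n | (u n).1 b]].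
pose h b := inf (S b).
have S0 b : S b !=set0 by exists 1; left.
have Slb b : lbound (S b) 0.
  by move=> _ [->|[n _ <-]] //; case/andP: (th01 n) => /ltW.
have h0 b : 0 <= h b by exact: lb_le_inf.
have h1 b : h b <= 1.
  by apply: ge_inf; [exists 0; exact: Slb|left].
have hU n b : (u n).1 b -> h b <= th n.
  by move=> nb; apply: ge_inf; [exists 0; exact: Slb|right; exists n].
have hnU n b : ~ (u n).1 b -> th n <= h b.
  move=> nb; apply: lb_le_inf => // _ [->|[m /= mb <-]].
    by case/andP: (th01 n) => _ /ltW.
  rewrite leNgt; apply/negP => mn.
  by have [/nuu|] := uc _ _ mn b; [exact|].
have hV n b : (u n).2 b -> th n <= h b.
  by move=> nb; apply: hnU => /nuu; exact.
exists h; split.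
- move=> b; apply/(@cvgrPdist_lt _ R) => e e0.
  have up : \forall z \near b, h z < h b + e.
    have [c1|c1] := ltP 1 (h b + e).
      by near=> z; apply: le_lt_trans c1.
    have [|n /andP[n1 n2]] := th_dense (h b) (h b + e) _ c1 (h0 b).
      by rewrite ltrDl.
    have nb : (u n).1 b.
      by apply: contrapT => /hnU; rewrite leNgt n1.
    have [[on _ _] _] := ug n.
    have : nbhs b (u n).1 by exact: open_nbhs_nbhs.
    by apply: filterS => z /hU zn; exact: le_lt_trans n2.
  have dn : \forall z \near b, h b - e < h z.
    have [c1|c1] := ltP (h b - e) 0.
      by near=> z; apply: lt_le_trans (h0 z).
    have [|n /andP[n1 n2]] := th_dense (h b - e) (h b) _ (h1 b) c1.
      by rewrite ltrBlDl ltrDr.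
    (* The threshold [n] only shows that [b] is outside [(u n).1]. The smaller threshold [m] then
       puts [b] into the open set [(u m).2], on which [h] is at least [th m]. *)
    have [|m /andP[m1 m2]] := th_dense (h b - e) (th n) n1 _ c1.
      by case/andP: (th01 n) => _ /ltW.
    have mb : (u m).2 b.
      have [//|/hU] := uc _ _ m2 b; by rewrite leNgt n2.
    have [[_ om _] _] := ug m.
    have : nbhs b (u m).2 by exact: open_nbhs_nbhs.
    by apply: filterS => z /hV zm; exact: lt_le_trans zm.
  near=> z; rewrite ltr_distl; apply/andP; split.
    by rewrite ltrBlDr; near: z.
  by rewrite -ltrBlDr; near: z.
- by move=> b; rewrite h0 h1.
- move=> b Eb; apply/eqP; rewrite eq_le h0 andbT leNgt; apply/negP => hb.
  have [n /andP[n0 n1]] := th_dense _ _ hb (h1 b) (lexx 0).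
  have [_ [_ _ En]] := ug n; have /hU := En _ Eb.
  by rewrite leNgt n1.
- move=> a; have /andP[t0 t1] := t01 a; apply/eqP; rewrite eq_le !leNgt.
  apply/andP; split; apply/negP => lt.
    have [n /andP[n1 n2]] := th_dense _ _ lt (h1 _) t0.
    have [_ [nU _ _]] := ug n.
    have /hU : (u n).1 (f a) by rewrite -[(u n).1 _]/((f @^-1` (u n).1) a) nU.
    by rewrite leNgt n2.
  have [n /andP[n1 n2]] := th_dense _ _ lt t1 (h0 _).
  have [_ [_ nV _]] := ug n.
  have /hV : (u n).2 (f a) by rewrite -[(u n).2 _]/((f @^-1` (u n).2) a) nV.
  by rewrite leNgt n1.
Unshelve. all: by end_near. Qed.

(** The line is squeezed into an open interval by x / (1 + |x|), whose inverse is x / (1 - |x|).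
    Since [left_orth_Urysohn] yields values in the closed interval, a second application is needed
    to avoid the end points. *)
Lemma left_orth_Tietze (R : realType) (t : A -> R) : continuous t ->
  exists h : B -> R, continuous h /\ forall a, h (f a) = t a.
Proof.
move=> ct.
have pos (x : R) : 0 < 1 + `|x| by rewrite ltr_wpDr.
pose t1 a := (1 + t a / (1 + `|t a|)) / 2.
have ct1 : continuous t1.
  apply: continuous_mulr; last exact: continuous_cstr.
  apply: continuous_addr; first exact: continuous_cstr.
  apply: continuous_divr => //.
  by apply: continuous_addr; [exact: continuous_cstr|exact: continuous_norm].
have tb a : -1 < t a / (1 + `|t a|) < 1.
  rewrite ltr_pdivrMr // ltr_pdivlMr // mulN1r mul1r -ltr_norml.
  by rewrite ltrDr.
have t101 a : 0 < t1 a < 1 by have /andP[? ?] := tb a; rewrite /t1;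
  apply/andP; split; lra.
have [|||h [ch h01 _ hf]] := @left_orth_Urysohn R t1 set0 ct1.
- by move=> a; have /andP[? ?] := t101 a; apply/andP; split; lra.
- exact: closed0.
- by [].
(* [E] misses the image of [f], as [t1] avoids 0 and 1; hence the value 1 on [A] is compatible with
   the value 0 on [E]. *)
pose E := h @^-1` [set 0; 1].
have [||||h' [ch' h'01 h'E h'f]] := @left_orth_Urysohn R (fun=> 1) E.
- by move=> a; exact: cvg_cst.
- by move=> a; rewrite ler01 lexx.
- apply: closed_comp => [b _|]; first exact: ch.
  by apply: closedU; exact: closed_eq.
- by move=> a [|] /=; rewrite hf => ta; have := t101 a; rewrite ta ltxx ?andbF.
(* [h'] pulls the values [0] and [1] of [h] back into the open interval. *)
pose k b := (2 * h b - 1) * h' b.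
have kb b : `|k b| < 1.
  have /andP[h0 h1] := h01 b; have /andP[h'0 h'1] := h'01 b.
  have [Eb|nE] := pselect (E b); first by rewrite /k h'E // mulr0 normr0.
  have : `|2 * h b - 1| < 1.
    have hn0 : h b != 0 by apply/eqP => hb; apply: nE; left.
    have hn1 : h b != 1 by apply/eqP => hb; apply: nE; right.
    move: hn0 hn1; rewrite ltr_norml.
    move: h0 h1; rewrite !le_eqVlt [0 == _]eq_sym => /orP[/eqP->|h0];
      first by rewrite eqxx.
    move=> /orP[/eqP->|h1']; first by rewrite eqxx.
    move=> _ _; apply/andP; split; lra.
  rewrite /k normrM (ger0_norm h'0) => hl.
  by apply: le_lt_trans hl; rewrite ler_piMr.
have kn b : 1 - `|k b| != 0 by rewrite gt_eqF // subr_gt0.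
exists (fun b => k b / (1 - `|k b|)); split.
  have ck : continuous k.
    apply: continuous_mulr => //.
    apply: continuous_subr; last exact: continuous_cstr.
    by apply: continuous_mulr => //; exact: continuous_cstr.
  apply: continuous_divr => //.
  by apply: continuous_subr; [exact: continuous_cstr|exact: continuous_norm].
move=> a; have -> : k (f a) = t a / (1 + `|t a|).
  by rewrite /k h'f hf /t1; lra.
have ta := pos (t a); have tn : 1 + `|t a| != 0 by rewrite gt_eqF.
rewrite normrM normfV (gtr0_norm ta).
have -> : 1 - `|t a| / (1 + `|t a|) = (1 + `|t a|)^-1.
  by apply: (mulIf tn); rewrite mulrBl mul1r divfK // addrK mulVf.
by rewrite invrK divfK.
Qed.

Lemma left_orth_R_omega (R : realType) (t : A -> R_omega R) : continuous t ->
  exists h : B -> R_omega R, continuous h /\ h \o f = t.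
Proof.
move=> ct.
have /choice[h hP] i : exists h : B -> R,
    continuous h /\ forall a, h (f a) = t a i.
  apply: left_orth_Tietze => a.
  by apply: (@continuous_comp _ _ _ t (fun y => y i));
    [exact: ct|exact: R_omega_proj_continuous].
exists (fun b i => h i b); split.
  by apply: continuous_R_omega => i; exact: (hP i).1.
by apply/funext => a; apply/funext => i; exact: (hP i).2.
Qed.

End left_orth.

Lemma retract_R_omega_right_orth (R : realType) (X : topologicalType) :
  is_retract_of X (R_omega R) -> right_orth (left_orth gen_maps) (to_point X).
Proof.
move=> [s [r [cs cr sK]]]; split; first by move=> x; exact: cvg_cst.
move=> A B f Pf t p ct _ _.
have cst : continuous (s \o t) by move=> a; apply: continuous_comp;
  [exact: ct|exact: cs].
have [h [ch hf]] := left_orth_R_omega Pf cst.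
exists (r \o h); split.
- by move=> b; apply: continuous_comp; [exact: ch|exact: cr].
- by rewrite -compA hf compA; apply/funext => a /=; rewrite sK.
- by apply/funext => b; rewrite /= /to_point; case: (p b).
Qed.

(** * The metric of the countable product of lines *)

(** A copy of the carrier of [R_omega], so that the metric below does not compete with the product
    topology; the two topologies are compared afterwards. *)
Definition seq_space (R : realType) := nat -> R.

Section seq_dist.
Context {R : realType}.
Implicit Types x y z : seq_space R.

(** The cap [n.+1%:R^-1] makes the supremum metric induce the product topology: at a given scale
    only finitely many coordinates matter. *)
Let trunc_dist n x y : R := Num.min `|x n - y n| n.+1%:R^-1.

Definition seq_dist x y : R := sup (range (fun n => trunc_dist n x y)).

Let trunc_dist_le n x y : trunc_dist n x y <= seq_dist x y.
Proof.
apply: ub_le_sup; last by exists n.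
exists 1 => _ [m _ <-]; rewrite /trunc_dist ge_min; apply/orP; right.
by rewrite invf_le1 // ler1n.
Qed.

Let seq_dist_le x y (c : R) : (forall n, trunc_dist n x y <= c) ->
  seq_dist x y <= c.
Proof. by move=> h; apply: ge_sup => [|_ [n _ <-] //];
  exists (trunc_dist 0 x y); exists 0%N. Qed.

Let seq_dist_xx x : seq_dist x x = 0.
Proof.
have h n : trunc_dist n x x = 0.
  by rewrite /trunc_dist subrr normr0 min_l // invr_ge0.
apply/eqP; rewrite eq_le; apply/andP; split.
  by apply: seq_dist_le => n; rewrite h.
by rewrite -(h 0%N).
Qed.

Lemma seq_dist_coord n x y (d : R) : seq_dist x y < d -> d <= n.+1%:R^-1 ->
  `|x n - y n| < d.
Proof.
move=> xyd dn; have := le_lt_trans (trunc_dist_le n x y) xyd.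
by rewrite /trunc_dist gt_min => /orP[//|]; rewrite ltNge dn.
Qed.

Lemma seq_dist_le_coord n x y (d : R) : n.+1%:R^-1 <= d ->
  (forall i, (i < n)%N -> `|x i - y i| <= d) -> seq_dist x y <= d.
Proof.
move=> nd h; apply: seq_dist_le => i; rewrite /trunc_dist ge_min.
case: (ltnP i n) => [/h -> //|ni]; apply/orP; right; apply: le_trans nd.
by rewrite lef_pV2 ?posrE ?ltr0n // ler_nat ltnS.
Qed.

Let seq_dist_eq0 x y : seq_dist x y = 0 -> x = y.
Proof.
move=> d0; apply/funext => n; apply/eqP; rewrite -subr_eq0 -normr_le0.
have := trunc_dist_le n x y; rewrite d0 /trunc_dist ge_min => /orP[//|].
by rewrite leNgt invr_gt0 ltr0n.
Qed.

Let seq_dist_sym x y : seq_dist x y = seq_dist y x.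
Proof.
by rewrite /seq_dist /trunc_dist; under eq_fun do rewrite distrC.
Qed.

Let seq_dist_triangle y x z : seq_dist x z <= seq_dist x y + seq_dist y z.
Proof.
apply: seq_dist_le => n; apply: le_trans (lerD (trunc_dist_le n x y)
  (trunc_dist_le n y z)).
have aux (a b c d : R) : 0 <= a -> 0 <= b -> 0 <= c -> d <= a + b ->
    Num.min d c <= Num.min a c + Num.min b c.
  move=> a0 b0 c0 dab.
  by case: (leP d) => ?; case: (leP a) => ?; case: (leP b) => ?; lra.
by apply: aux => //; exact: ler_distD.
Qed.

HB.instance Definition _ := gen_eqMixin (seq_space R).
HB.instance Definition _ := gen_choiceMixin (seq_space R).
HB.instance Definition _ := isMetric.Build R (seq_space R) seq_dist_xx
  seq_dist_eq0 seq_dist_sym seq_dist_triangle.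

End seq_dist.

Lemma natSinv_lt (R : realType) (e : R) : 0 < e -> exists n, n.+1%:R^-1 < e.
Proof. by move=> /ltr_add_invr[n]; rewrite add0r; exists n. Qed.

Lemma R_omega_seq_space_continuous (R : realType) :
  continuous (id : R_omega R -> seq_space R).
Proof.
move=> x; apply/(@cvg_ballP R (seq_space R) _ (nbhs (x : R_omega R))) => e e0.
  have [n ne] := natSinv_lt (divr_gt0 e0 (ltr0Sn _ 1)).
  have : nbhs x [set y : R_omega R | forall i : 'I_n, `|x i - y i| < e / 2].
    apply: (@filter_forall _ _ (fun (i : 'I_n) (y : R_omega R) => `|x i - y i|
      < e / 2) _ (nbhs_filter (x : R_omega R))) => i.
    have /(@cvgrPdist_lt _ R) := @R_omega_proj_continuous R i x.
    by apply; rewrite divr_gt0.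
  apply: filterS => y xy; rewrite ballEmdist.
  apply: (@le_lt_trans _ _ (e / 2));
    last by rewrite ltr_pdivrMr // ltr_pMr // ltr1n.
  apply: (seq_dist_le_coord (ltW ne)) => i ilt.
  by apply: ltW; have := xy (Ordinal ilt).
Qed.

Lemma seq_space_R_omega_continuous (R : realType) :
  continuous (id : seq_space R -> R_omega R).
Proof.
apply: continuous_R_omega => i x.
apply/(@cvgrPdist_lt _ R _ (nbhs (x : seq_space R))) => e e0.
  have d0 : 0 < Num.min e i.+1%:R^-1 by rewrite lt_min e0 invr_gt0 ltr0n.
  have : nbhs x (ball x (Num.min e i.+1%:R^-1)) by exact: nbhsx_ballx.
  apply: filterS => y; rewrite ballEmdist => /= xy.
  have := @seq_dist_coord R i x y _ xy; rewrite ge_min lexx orbT => /(_ isT) h.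
  by apply: lt_le_trans h _; rewrite ge_min lexx.
Qed.

Lemma metrisable_R_omega (R : realType) : metrisable R (R_omega R).
Proof.
exists (seq_space R), id, id; split => //.
  exact: R_omega_seq_space_continuous.
exact: seq_space_R_omega_continuous.
Qed.

Lemma nbhs_R_omega (R : realType) (x : R_omega R) (O : set (R_omega R)) :
  nbhs x O -> exists n (d : R), 0 < d /\
    forall y : R_omega R, (forall i, (i < n)%N -> `|x i - y i| <= d) -> O y.
Proof.
move=> /(@seq_space_R_omega_continuous R).
rewrite -[X in X _ -> _]/(nbhs (x : seq_space R)) -filter_from_ballE.
move=> [e /= e0 eO].
have [n ne] := natSinv_lt (divr_gt0 e0 (ltr0Sn _ 1)).
exists n, (e / 2); split; first by rewrite divr_gt0.
move=> y xy; apply: eO; rewrite ballEmdist.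
apply: (@le_lt_trans _ _ (e / 2));
  last by rewrite ltr_pdivrMr // ltr_pMr // ltr1n.
exact: (seq_dist_le_coord (ltW ne)).
Qed.

(** The rational sequences of finite support, indexed by lists, are dense. *)
Lemma separable_R_omega (R : realType) : separable_space (R_omega R).
Proof.
pose D (s : seq rat) : R_omega R := fun i => ratr (nth 0 s i).
exists (range D).
  by apply: card_le_trans (card_image_le _ _) _; exact: countableP.
move=> O [x Ox] oO.
have /nbhs_R_omega[n [d [d0 dO]]] : nbhs x O by exact: open_nbhs_nbhs.
have /choice[q qP] i : exists q : rat, `|x i - ratr q| <= d.
  have [|q] := @rat_in_itvoo R (x i) (x i + d); first by rewrite ltrDl.
  rewrite in_itv /= => /andP[q1 q2]; exists q.
  by rewrite ler_distlC; apply/andP; split; lra.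
exists (D (mkseq q n)); split; last by exists (mkseq q n).
by apply: dO => i ilt; rewrite /D nth_mkseq.
Qed.

(** * Lipschitz functions on a metric space *)

Section lipschitz.
Context {R : realType} {M : metricType R}.

Lemma lipschitz_continuous (h : M -> R) :
  (forall x y, h x <= h y + mdist x y) -> continuous h.
Proof.
move=> hL x; apply/(@cvgrPdist_lt _ R) => e e0.
have : nbhs x (ball x e) by exact: nbhsx_ballx.
apply: filterS => y; rewrite ballEmdist /= => xy.
have := hL x y; have := hL y x; rewrite [mdist y x]metric_sym => h1 h2.
by rewrite ltr_norml; apply/andP; split; lra.
Qed.

Lemma lipschitz_sup (I : Type) (g : I -> M -> R) : inhabited I ->
  (forall i x y, g i x <= g i y + mdist x y) ->
  (forall x, has_ubound (range (g^~ x))) ->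
  forall x y, sup (range (g^~ x)) <= sup (range (g^~ y)) + mdist x y.
Proof.
move=> [i0] gL gb x y; apply: ge_sup; first by exists (g i0 x), i0.
move=> _ [i _ <-]; apply: le_trans (gL i x y) _.
by rewrite lerD2r; apply: ub_le_sup => //; exists i.
Qed.

End lipschitz.

(** * Closed embedding of separable completely metrisable spaces *)

Section complete_embedding.
Context {R : realType} {M : metricType R} (D : nat -> M).
Hypothesis denseD : forall x (e : R), 0 < e -> exists n, mdist x (D n) < e.
Hypothesis completeM :
  forall u : nat -> M, cauchy (u @ \oo) -> exists l : M, u @ \oo --> l.

(** Positive exactly on the ball of radius [k.+1%:R^-1] about [D n], and at most [n.+1%:R^-1]. A
    positive lower bound on the supremum over [n] thus confines [x] to finitely many of these
    balls. *)
Let weight k n (x : M) : R := (k.+1%:R^-1 - mdist x (D n)) / n.+1%:R.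

Let weight_lip k n x y : weight k n x <= weight k n y + mdist x y.
Proof.
have n0 : 0 < n.+1%:R :> R by [].
rewrite /weight -lerBlDl -mulrBl ler_pdivrMr //.
apply: (@le_trans _ _ (mdist x y)).
  have aux (k' a b c : R) : b <= c + a -> k' - a - (k' - b) <= c by lra.
  by apply: aux; have := metric_triangle y x (D n);
    rewrite [mdist y x]metric_sym.
by rewrite ler_peMr ?mdist_ge0 // ler1n.
Qed.

Let weight_ub k x : has_ubound (range (fun n => weight k n x)).
Proof.
exists 1 => _ [n _ <-]; rewrite /weight ler_pdivrMr // mul1r.
apply: (@le_trans _ _ 1); last by rewrite ler1n.
rewrite lerBlDr; apply: (@le_trans _ _ 1); first by rewrite invf_le1 // ler1n.
by rewrite lerDl mdist_ge0.
Qed.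

Let total_weight k x : R := sup (range (fun n => weight k n x)).

Let total_weight_gt0 k x : 0 < total_weight k x.
Proof.
have [|n xn] := @denseD x k.+1%:R^-1; first by rewrite invr_gt0.
apply: (@lt_le_trans _ _ (weight k n x)).
  by rewrite /weight divr_gt0 // subr_gt0.
by apply: ub_le_sup => //; exists n.
Qed.

Let total_weight_continuous k : continuous (total_weight k).
Proof.
apply: lipschitz_continuous => x y.
by apply: (@lipschitz_sup _ _ nat) => //; exact: weight_lip.
Qed.

(* The odd coordinates blow up along every sequence with no Cauchy subnet. *)
Let emb (x : M) : R_omega R := fun i =>
  if odd i then (total_weight i./2 x)^-1 else mdist x (D i./2).

Let emb_dist n x : emb x n.*2 = mdist x (D n).
Proof. by rewrite /emb odd_double doubleK. Qed.

Let emb_weight k x : emb x k.*2.+1 = (total_weight k x)^-1.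
Proof. by rewrite /emb /= odd_double /= uphalf_double. Qed.

Let emb_continuous : continuous emb.
Proof.
apply: continuous_R_omega => i; rewrite /emb; case: (odd i).
  move=> x; apply: cvgV; first by rewrite gt_eqF.
  exact: total_weight_continuous.
apply: lipschitz_continuous => x y.
by rewrite addrC; exact: metric_triangle.
Qed.

(** A single coordinate suffices: the distance to some [D n] within [e / 3] of [x]. *)
Let emb_close x (e : R) : 0 < e -> exists n (d : R), 0 < d /\
  forall y, `|emb y n - emb x n| < d -> mdist x y < e.
Proof.
move=> e0; have [|n xn] := @denseD x (e / 3); first by rewrite divr_gt0.
exists n.*2, (e / 3); split; first by rewrite divr_gt0.
move=> y; rewrite !emb_dist ltr_distl => /andP[_ yn].
apply: le_lt_trans (metric_triangle x (D n) y) _.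
rewrite [mdist _ y]metric_sym; lra.
Qed.

Let emb_injective : injective emb.
Proof.
move=> x y xy; apply/eqP; apply: contrapT => /negP; rewrite -mdist_gt0 => d0.
have [n [d [d00 /(_ y)]]] := emb_close x d0.
by rewrite xy subrr normr0 ltxx => /(_ d00).
Qed.

Let emb_open : @open M = [set emb @^-1` V | V in @open (R_omega R)].
Proof.
apply/seteqP; split => U; last first.
  by move=> [V oV <-]; move/continuousP : emb_continuous; exact.
move=> oU; exists (\bigcup_(W in [set W | open W /\ emb @^-1` W `<=` U]) W).
  by apply: bigcup_open => W [].
apply/seteqP; split => x /=; first by move=> [W [_ WU]] /WU.
move=> Ux; have : nbhs x U by exact: open_nbhs_nbhs.
rewrite -filter_from_ballE => -[e /= e0 eU].
have [n [d [d0 nd]]] := emb_close x e0.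
exists [set z : R_omega R | `|z n - emb x n| < d];
  last by rewrite /= subrr normr0.
split; last by move=> y /= /nd xy; apply: eU; rewrite ballEmdist.
apply: (@open_comp _ _ (fun z : R_omega R => `|z n - emb x n|) [set r | r < d]).
  move=> z _; apply: continuous_norm; apply: continuous_subr.
    exact: R_omega_proj_continuous.
  exact: continuous_cstr.
exact: open_lt.
Qed.

(** The neighbourhoods of [y] pull back to a proper filter on [M], refined to an ultrafilter [G].
    For each [k] some ball of radius [k.+1%:R^-1] belongs to [G]; the centres form a Cauchy
    sequence, and its limit is the limit of [G], hence is mapped to [y]. *)
Let emb_closed : closed (range emb).
Proof.
move=> y cy.
have PF : ProperFilter (filter_from (nbhs y) (fun N => emb @^-1` N)).
  apply: filter_from_proper; last first.
    by move=> N /cy[_ [[x _ <-] Nx]]; exists x.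
  apply: filter_from_filter; first by exists setT; exact: filterT.
  by move=> N1 N2 y1 y2; exists (N1 `&` N2) => //; exact: filterI.
have [G [UG FG]] := ultraFilterLemma PF.
have GN N : nbhs y N -> G (emb @^-1` N) by move=> yN; apply: FG; exists N.
have /choice[c cP] k : exists n, G [set x | mdist (D n) x < k.+1%:R^-1].
  (* The inverse total weight is below [C] on a member of [G]. A weight above [C^-1] can only come
     from an index [n] with [n.+1 < C], so finitely many balls cover that member and the ultrafilter
     contains one of them. *)
  pose C := y k.*2.+1 + 1.
  have GC : G [set x | (total_weight k x)^-1 < C].
    rewrite [mkset _](_ : _ = emb @^-1` [set z | z k.*2.+1 < C]); last first.
      by apply/seteqP; split => x /=; rewrite emb_weight.
    apply: GN; apply: open_nbhs_nbhs; split; last by rewrite /C /= ltrDl.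
    apply: (@open_comp _ _ (fun z : R_omega R => z k.*2.+1) [set r | r < C]).
      by move=> z _; exact: R_omega_proj_continuous.
    exact: open_lt.
  apply: contrapT => /forallNP nG.
  have : G [set x | forall i : 'I_(Num.truncn C).+1, ~ mdist (D i) x <
    k.+1%:R^-1].
    apply: filter_forall => i.
    by have [/nG//|] := in_ultra_setVsetC [set x | mdist (D i) x < k.+1%:R^-1]
      UG.
  move=> /(filterI GC)/filter_ex[x [/= xC xi]].
  have w0 := total_weight_gt0 k x.
  have C0 : 0 < C by apply: lt_trans xC; rewrite invr_gt0.
  have [_ [n _ <-]] : exists2 r, range (fun n => weight k n x) r & C^-1 < r.
    apply: sup_gt; first by exists (weight k 0 x), 0%N.
    by rewrite -[ltRHS]invrK ltf_pV2 // posrE invr_gt0.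
  rewrite /weight ltr_pdivlMr // => h.
  have xn : mdist (D n) x < k.+1%:R^-1.
    rewrite metric_sym -subr_gt0; apply: lt_trans h.
    by rewrite mulr_gt0 // invr_gt0.
  have nC : (n < (Num.truncn C).+1)%N.
    rewrite ltnS leqNgt -ltnS; apply/negP => nC; move: h.
    rewrite ltNge => /negP; apply.
    apply: (@le_trans _ _ 1).
      apply: (@le_trans _ _ k.+1%:R^-1); first by rewrite gerBl mdist_ge0.
      by rewrite invf_le1 // ler1n.
    rewrite ler_pdivlMl // mulr1.
    apply: le_trans (ltW (truncnS_gt C)) _.
    by rewrite ler_nat ltnW.
  by have := xi (Ordinal nC); apply.
have inv_small (e : R) : 0 < e -> \forall k \near \oo, k.+1%:R^-1 < e.
  by move=> e0; have := near_infty_natSinv_lt (PosNum e0).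
(* Two balls belonging to [G] meet, which bounds the distance of their centres by the sum of the
   radii. *)
have cauchyc : cauchy (D \o c @ \oo).
  apply/cauchy_ballP => e e0.
  have e20 : 0 < e / 2 by rewrite divr_gt0.
  exists ((D \o c) @` [set k | k.+1%:R^-1 < e / 2],
          (D \o c) @` [set k | k.+1%:R^-1 < e / 2]) => /=.
    have : (D \o c @ \oo) ((D \o c) @` [set k | k.+1%:R^-1 < e / 2]).
      by have := inv_small _ e20; apply: filterS => k ke; exists k.
    by [].
  move=> [_ _] [/= [k ke <-] [l le <-]].
  have /filter_ex[x [xk xl]] : G ([set x | mdist (D (c k)) x < k.+1%:R^-1] `&`
      [set x | mdist (D (c l)) x < l.+1%:R^-1]) by exact: filterI.
  rewrite ballEmdist /=; apply: le_lt_trans (metric_triangle _ x _) _.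
  rewrite [mdist x _]metric_sym [e]splitr.
  by apply: ltrD; [exact: lt_trans xk ke|exact: lt_trans xl le].
have [l cl] := completeM cauchyc; exists l => //.
have Gl : G --> l.
  apply/cvg_ballP => e e0; have e20 : 0 < e / 2 by rewrite divr_gt0.
  have /(@cvg_ballP _ M)/(_ _ e20) := cl.
  move=> /(filterI (inv_small _ e20))/filter_ex[k [/= ke]].
  rewrite ballEmdist /= => lk; have := cP k; apply: filterS => x /= kx.
  rewrite ballEmdist /=; apply: le_lt_trans (metric_triangle _ (D (c k)) _) _.
  by rewrite [e]splitr; apply: ltrD => //; exact: lt_trans kx ke.
apply/funext => i.
have ci : continuous (fun x => emb x i).
  move=> x; apply: (@continuous_comp _ _ _ emb (fun z : R_omega R => z i)).
    exact: emb_continuous.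
  exact: R_omega_proj_continuous.
apply: (@cvg_unique R (@norm_hausdorff R R) ((fun x => emb x i) @ G)).
- by move=> N lN; apply: Gl; exact: ci.
- move=> N yN; apply: (GN ((fun z : R_omega R => z i) @^-1` N)).
  exact: R_omega_proj_continuous.
Qed.

Lemma complete_closed_embedding :
  exists e : M -> R_omega R, closed_embedding e.
Proof. by exists emb; split; [exact: emb_injective|exact: emb_open|exact:
  emb_closed]. Qed.
End complete_embedding.

Lemma separable_completely_metrisable_closed_embedding (R : realType)
    (X : topologicalType) : separable_space X -> completely_metrisable R X ->
  exists e : X -> R_omega R, closed_embedding e.
Proof.
move=> [D0 /countable_injP[f fI] dD0] [M [[p [q [cp cq pK qK]]] cM]].
(* Enumerating the dense set by all of [nat] takes a default point, so the empty space is treated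
   apart. *)
have [[x0 _]|X0] := pselect (exists x : X, True); last first.
  have noX (x : X) : False by apply: X0; exists x.
  exists (fun x => False_rect (R_omega R) (noX x)); split.
  - by move=> x; case: (noX x).
  - apply/seteqP; split => U.
      by move=> _; exists setT; [exact: openT|apply/funext => x; case: (noX x)].
    move=> _; rewrite (_ : U = setT); first exact: openT.
    by apply/funext => x; case: (noX x).
  - rewrite [X in closed X](_ : _ = set0); first exact: closed0.
    by apply/seteqP; split => // y [x]; case: (noX x).
pose u n := if pselect (exists2 x, D0 x & f x = n) is left h
  then projT1 (cid2 h) else x0.
have uP x : D0 x -> u (f x) = x.
  move=> Dx; rewrite /u; case: pselect => [h|[]]; last by exists x.
  by case: (cid2 h) => y Dy fy /=; apply: fI => //; exact: mem_set.
have dense_pu x (e : R) : 0 < e -> exists n, mdist x (p (u n)) < e.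
  move=> e0; have := nbhsx_ballx x e e0; rewrite nbhsE => -[W [oW Wx] We].
  have [||y [Wy Dy]] := dD0 (p @^-1` W).
  - by exists (q x); rewrite /preimage /= qK.
  - by move/continuousP : cp; exact.
  by exists (f y); rewrite uP //; have := We _ Wy; rewrite ballEmdist.
have [e [eI eO eC]] := complete_closed_embedding dense_pu cM.
exists (e \o p); split.
- by apply: inj_comp => //; exact: can_inj pK.
- apply/seteqP; split => U; last first.
    move=> [V oV <-]; have oeV : @open M (e @^-1` V) by rewrite eO; exists V.
    by move/continuousP : cp => /(_ _ oeV).
  move=> oU; have : open (q @^-1` U) by move/continuousP : cq; exact.
  rewrite eO => -[V oV VU]; exists V => //.
  rewrite comp_preimage VU -comp_preimage.
  by apply/seteqP; split => x /=; rewrite pK.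
- rewrite [X in closed X](_ : _ = range e) //; apply/seteqP;
    split => [_ [x _ <-]|_ [m _ <-]].
    by exists (p x).
  by exists (q m) => //=; rewrite qK.
Qed.

(** * The elementary implications *)

(** Every square over the point commutes, so here lifting is plain extension. *)
Lemma right_orth_extension (X A B : topologicalType) (f : A -> B) (t : A -> X) :
  right_orth (left_orth gen_maps) (to_point X) -> left_orth gen_maps f ->
  continuous t -> exists h : B -> X, continuous h /\ h \o f = t.
Proof.
move=> [_ rX] Pf ct; have [|||h [ch hf _]] := rX _ _ f Pf t (to_point B) => //.
  by move=> x; exact: cvg_cst.
by exists h.
Qed.

Lemma right_orth_absolute_retract (R : realType) (X : topologicalType) :
  right_orth (left_orth gen_maps) (to_point X) -> absolute_retract R X.
Proof.
move=> rX Z i _ mZ cei.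
have ci : continuous (id : X -> X) by move=> x; exact: cvg_id.
have [r [cr ri]] :=
  right_orth_extension rX (closed_embedding_left_orth mZ cei) ci.
by exists r; split => // x; have := congr1 (@^~ x) ri.
Qed.

Lemma right_orth_absolute_extensor (R : realType) (X : topologicalType) :
  right_orth (left_orth gen_maps) (to_point X) -> absolute_extensor R X.
Proof.
move=> rX Z A f _ mZ cA cf; apply: right_orth_extension => //.
by apply: closed_embedding_left_orth mZ _; exact: closed_embedding_set_val.
Qed.

Lemma absolute_retract_retract_R_omega (R : realType) (X : topologicalType)
    (e : X -> R_omega R) : closed_embedding e -> absolute_retract R X ->
  is_retract_of X (R_omega R).
Proof.
move=> cee /(_ _ e (separable_R_omega R) (metrisable_R_omega R) cee)[r [cr er]].
by exists e, r; split => //; exact: closed_embedding_continuous cee.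
Qed.

(** The map to extend is the inverse of [e] on the closed set [range e]. *)
Lemma absolute_extensor_retract_R_omega (R : realType) (X : topologicalType)
    (e : X -> R_omega R) : closed_embedding e -> absolute_extensor R X ->
  is_retract_of X (R_omega R).
Proof.
move=> cee aX; have [eI eO eC] := cee.
have /choice[g gP] (a : range e) : exists x, e x = set_val a.
  by have [x _ ex] := set_valP a; exists x.
have cg : continuous g.
  apply/continuousP => U; rewrite eO => -[V oV <-].
  by exists V => //; apply/seteqP; split => a /=; rewrite gP.
have [r [cr rg]] := aX _ _ g (separable_R_omega R) (metrisable_R_omega R) eC cg.
exists e, r; split => //; first exact: closed_embedding_continuous cee.
move=> x; have ex : range e (e x) by exists x.
apply: eI; pose a : range e := exist _ (e x) (mem_set ex).
by have := congr1 (@^~ a) rg => /= ->; rewrite gP.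
Qed.

(** The straight-line contraction of [R_omega] to the origin is pushed forward by [r]. *)
Lemma retract_R_omega_contractible (R : realType) (X : topologicalType) :
  is_retract_of X (R_omega R) -> contractible R X.
Proof.
move=> [s [r [cs cr sK]]].
exists (r (fun=> 0)), (fun p => r (fun i => (1 - p.2) * s p.1 i)); split.
- apply: continuous_subspaceT.
  have ch : continuous (fun p : X * R => (fun i => (1 - p.2) * s p.1 i) :
    R_omega R).
    apply: continuous_R_omega => i; apply: continuous_mulr.
      apply: continuous_subr; first exact: continuous_cstr.
      by move=> p; exact: cvg_snd.
    move=> p; apply: (@continuous_comp _ _ _ (fun p : X * R => s p.1) (fun y :
      R_omega R => y i)).
      by apply: (@continuous_comp _ _ _ fst s); [exact: cvg_fst|exact: cs].
    exact: R_omega_proj_continuous.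
  move=> p; apply: (@continuous_comp _ _ _ _ r); [exact: ch|exact: cr].
- move=> x /=; rewrite -[RHS]sK; congr r; apply/funext => i.
  by rewrite subr0 mul1r.
- by move=> x /=; congr r; apply/funext => i; rewrite subrr mul0r.
Qed.

(** * Continuity on subsets, and the Euclidean norm *)

Lemma within_eq (T S : topologicalType) (A : set T) (k l : T -> S) :
  (forall x, A x -> k x = l x) -> {within A, continuous k} ->
  {within A, continuous l}.
Proof.
by move=> kl; apply: subspace_eq_continuous => x /set_mem; exact: kl.
Qed.

Lemma within_comp (T U V : topologicalType) (A : set T) (B : set U)
    (k : T -> U) (l : U -> V) : (forall x, A x -> B (k x)) ->
  {within A, continuous k} -> {within B, continuous l} ->
  {within A, continuous (l \o k)}.
Proof.
move=> AB /subspace_continuousP ck /subspace_continuousP cl.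
apply/subspace_continuousP => x Ax W /(cl _ (AB _ Ax)) lW.
have := ck _ Ax _ lW; apply: filterS2 (withinT A (nbhs_filter x)) => y.
by move=> Ay; apply; exact: AB.
Qed.

Lemma within_pair (T U V : topologicalType) (A : set T) (k : T -> U)
    (l : T -> V) : {within A, continuous k} -> {within A, continuous l} ->
  {within A, continuous (fun x => (k x, l x))}.
Proof. by move=> ck cl x; apply: cvg_pair; [exact: ck|exact: cl]. Qed.

Lemma continuous_mx (R : realType) (T : topologicalType) m n
    (h : T -> 'M[R]_(m, n)) :
  (forall i j, continuous (fun x => h x i j)) -> continuous h.
Proof.
move=> ch x W [P hP PW]; rewrite nbhs_simpl /=.
have : nbhs x [set y | forall ij : 'I_m * 'I_n, P ij.1 ij.2 (h y ij.1 ij.2)].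
  by apply: filter_forall => ij; exact/ch/hP.
by apply: filterS => y Py; apply: PW => i j; exact: (Py (i, j)).
Qed.

Lemma continuous_maxr (R : realType) (T : topologicalType) (k l : T -> R) :
  continuous k -> continuous l -> continuous (fun x => Num.max (k x) (l x)).
Proof.
move=> ck cl x; have := @continuous_max R T k l x.
by apply; [exact: ck|exact: cl].
Qed.

Lemma continuous_sumr (R : realType) (T : topologicalType) (I : Type)
    (s : seq I) (k : I -> T -> R) : (forall i, continuous (k i)) ->
  continuous (fun x => \sum_(i <- s) k i x).
Proof.
move=> ck; elim: s => [|i s IH].
  by rewrite (_ : (fun _ => _) = (fun=> 0)); [exact: continuous_cstr|
    apply/funext => x; rewrite big_nil].
rewrite (_ : (fun _ => _) = (fun x => k i x + \sum_(j <- s) k j x)).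
  exact: continuous_addr.
by apply/funext => x; rewrite big_cons.
Qed.

Definition norm2 (R : realType) n (v : 'rV[R]_n) : R :=
  Num.sqrt (\sum_i v ord0 i ^+ 2).

Section norm2.
Context {R : realType} {n : nat}.
Implicit Types v : 'rV[R]_n.

Lemma sum_sqr_ge0 v : 0 <= \sum_i v ord0 i ^+ 2.
Proof. by apply: sumr_ge0 => i _; exact: sqr_ge0. Qed.

Lemma norm2_ge0 v : 0 <= norm2 v.
Proof. exact: sqrtr_ge0. Qed.

Lemma norm2_sqr v : norm2 v ^+ 2 = \sum_i v ord0 i ^+ 2.
Proof. by rewrite sqr_sqrtr // sum_sqr_ge0. Qed.

Lemma norm2_continuous : continuous (@norm2 R n).
Proof.
move=> v; apply: (@continuous_comp _ _ _ (fun v : 'rV[R]_n => \sum_i v ord0 i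
  ^+ 2)).
  apply: (@continuous_sumr _ _ _ (index_enum _) (fun i v => v ord0 i ^+ 2)) =>
    i.
  by apply: continuous_mulr; exact: coord_continuous.
exact: sqrt_continuous.
Qed.

Lemma norm2Z (a : R) v : 0 <= a -> norm2 (a *: v) = a * norm2 v.
Proof.
move=> a0; rewrite /norm2 -[in RHS](ger0_norm a0) -sqrtr_sqr -sqrtrM ?sqr_ge0
  //.
by congr Num.sqrt; rewrite mulr_sumr; apply: eq_bigr => i _; rewrite mxE exprMn.
Qed.

End norm2.

Lemma sphere_norm2 (R : realType) n (v : 'rV[R]_n.+1) :
  sphere R n v <-> norm2 v = 1.
Proof.
rewrite /sphere /= -norm2_sqr; split => [/eqP|->]; last by rewrite expr1n.
by rewrite sqrp_eq1 ?norm2_ge0 // => /eqP.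
Qed.

Lemma disk_norm2 (R : realType) n (v : 'rV[R]_n) : disk R n v <-> norm2 v <= 1.
Proof. by rewrite /disk /= -norm2_sqr expr_le1 // norm2_ge0. Qed.

(** The contraction is run radially: time 0 on the unit sphere, time 1 on the sphere of radius 1/2,
    and the constant [x0] inside. Stopping at radius 1/2 avoids the origin, where the direction is
    undefined. *)
Lemma contractible_homotopically_trivial (R : realType) (X : topologicalType) :
  contractible R X -> homotopically_trivial R X.
Proof.
move=> [x0 [H [cH H0 H1]]]; split; first by exists x0.
move=> n f cf.
pose f' := valL_ x0 f.
have cf' : {within sphere R n, continuous f'} by
  exact/subspace_valL_continuousP'.
(* The maximum with [2^-1] makes [dir] continuous everywhere without changing the normalised vector
   on [A2]. *)
pose dir (v : 'rV[R]_n.+1) := (Num.max (norm2 v) 2^-1)^-1 *: v.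
have pos (v : 'rV[R]_n.+1) : 0 < Num.max (norm2 v) 2^-1.
  by rewrite lt_max invr_gt0 ltr0n orbT.
have cdir : continuous dir.
  apply: continuous_mx => i j.
  rewrite /dir; under eq_fun do rewrite mxE mulrC.
  apply: continuous_divr => [v||v]; first exact: coord_continuous.
    apply: continuous_maxr; first exact: norm2_continuous.
    exact: continuous_cstr.
  by rewrite gt_eqF.
pose A1 : set 'rV[R]_n.+1 := [set v | norm2 v <= 2^-1].
pose A2 : set 'rV[R]_n.+1 := [set v | 2^-1 <= norm2 v] `&` [set v | norm2 v <=
  1].
have closed_norm2 (S : set R) : closed S -> closed (@norm2 R n.+1 @^-1` S).
  by move=> cS; apply: closed_comp => // v _; exact: norm2_continuous.
have cA1 : closed A1 by apply: (closed_norm2 [set r | r <= 2^-1]);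
  exact: closed_le.
have cA2 : closed A2.
  apply: closedI.
    by apply: (closed_norm2 [set r | 2^-1 <= r]); exact: closed_ge.
  by apply: (closed_norm2 [set r | r <= 1]); exact: closed_le.
have dirA2 v : A2 v -> norm2 (dir v) = 1.
  move=> [/= v2 v1]; rewrite norm2Z ?invr_ge0 ?(ltW (pos v)) // max_l //.
  by rewrite mulVf // gt_eqF // (lt_le_trans _ v2).
pose g (v : 'rV[R]_n.+1) := if norm2 v <= 2^-1 then x0 else
  H (f' (dir v), 2 - 2 * norm2 v).
have gA2 v : A2 v -> g v = H (f' (dir v), 2 - 2 * norm2 v).
  move=> [/= v2 v1]; rewrite /g; case: ifPn => // v2'.
  have -> : norm2 v = 2^-1 by apply/eqP; rewrite eq_le v2 v2'.
  have -> : 2 - 2 * 2^-1 = 1 :> R by lra.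
  exact/esym/H1.
have cg : {within disk R n.+1, continuous g}.
  apply: (@continuous_subspaceW _ _ (disk R n.+1) (A1 `|` A2)).
    move=> v /disk_norm2 v1; rewrite /A1 /A2 /setU /setI /=.
    by case: (leP (norm2 v) 2^-1) => [|/ltW] h; [left|right].
  apply: withinU_continuous => //.
    apply: (@within_eq _ _ _ (fun=> x0)); last by move=> v; exact: cvg_cst.
    by move=> v v1; rewrite /g ifT.
  apply: (@within_eq _ _ _ (H \o (fun v => (f' (dir v), 2 - 2 * norm2 v)))).
    by move=> v /gA2 ->.
  apply: (@within_comp _ (X * R)%type _ A2 ([set: X] `*` `[0, 1]) (fun v => (f'
    (dir v), 2 - 2 * norm2 v)) H) => //.
    move=> v [/= v2 v1]; split => //=; rewrite in_itv /=; apply/andP; split;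
      lra.
  apply: within_pair.
    apply: (@within_comp _ _ _ A2 (sphere R n) dir f') => //.
      by move=> v /dirA2 v1; apply/sphere_norm2.
    exact: continuous_subspaceT.
  apply: continuous_subspaceT; apply: continuous_subr.
    exact: continuous_cstr.
  apply: continuous_mulr; first exact: continuous_cstr.
  exact: norm2_continuous.
exists (sigL (disk R n.+1) g); split; first exact/subspace_sigL_continuousP.
move=> s d sd; have : sphere R n (set_val d) by rewrite -sd; exact: set_valP.
move=> /sphere_norm2 nd.
have h2 : (2^-1 : R) < 1 by lra.
rewrite /sigL /= /g nd leNgt h2 /= mulr1 subrr H0.
have -> : dir (set_val d) = set_val d by rewrite /dir nd max_l ?invr1 ?scale1r
  // ltW.
by rewrite -sd -[RHS](congr1 (@^~ s) (@valLK _ _ x0 (sphere R n) f)).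
Qed.

(** * Cubical grids *)

Lemma cvg_R_omega (R : realType) (T : Type) (F : set_system T) (FF : Filter F)
    (h : T -> R_omega R) (l : R_omega R) :
  (forall i, (fun x => h x i) @ F --> l i) -> h @ F --> l.
Proof. by move=> hl; apply/(@pointwise_cvgP nat R) => i; exact: hl. Qed.

Lemma mx_norm_coord_le (R : realType) n (v : 'rV[R]_n) j :
  `|v ord0 j| <= mx_norm v.
Proof. by rewrite mx_normrE; exact: (le_bigmax _ (fun ij => `|v ij.1 ij.2|)
  (ord0, j)). Qed.

(** Total maps that are continuous within a set compose and glue more easily than maps on
    subtypes. *)
Lemma homotopically_trivial_within (R : realType) (X : topologicalType)
    (n : nat) (f : 'rV[R]_n.+1 -> X) : homotopically_trivial R X ->
  {within sphere R n, continuous f} ->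
  exists g : 'rV[R]_n.+1 -> X, {within disk R n.+1, continuous g} /\
    forall v, sphere R n v -> g v = f v.
Proof.
move=> [[x0 _] hX] cf.
have [|g [cg gf]] := hX n (sigL (sphere R n) f).
  exact/subspace_sigL_continuousP.
exists (valL_ x0 g); split; first exact/subspace_valL_continuousP'.
move=> v sv; have dv : disk R n.+1 v.
  by apply/disk_norm2; move/sphere_norm2 : sv => ->.
pose d : disk R n.+1 := exist _ v (mem_set dv).
pose s : sphere R n := exist _ v (mem_set sv).
rewrite -[LHS]/(sigL (disk R n.+1) (valL_ x0 g) d) valLK.
exact: (gf s d).
Qed.

Section cells.
Context {R : realType} {n m : nat} (a d : R) (d_gt0 : 0 < d).

Implicit Types e c : ({ffun 'I_n -> 'I_m.+1} * {set 'I_n})%type.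

Let pt (k : nat) : R := a + d * k%:R.

Let pt_lt k l : (pt k < pt l) = (k < l)%N.
Proof. by rewrite ltrD2l ltr_pM2l // ltr_nat. Qed.

(* The pair [(k, D)] encodes the face of the grid with free coordinates [D] and
   lowest corner [pt \o k]. *)
Definition cell e : set (R_omega R) :=
  [set y : R_omega R | (forall i : 'I_n, if i \in e.2 then pt (e.1 i) <= y i <=
    pt (e.1 i).+1
                            else y i == pt (e.1 i)) /\
           forall i, (n <= i)%N -> y i = 0].

(** Empty when [e.2] is empty: a vertex has no boundary. *)
Definition cell_boundary e : set (R_omega R) :=
  [set y | cell e y /\
    exists2 i, i \in e.2 & (y i == pt (e.1 i)) || (y i == pt (e.1 i).+1)].

(** A corner index ranges over 0, ..., m; in a free direction the value m is excluded, because the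
    cell would stick out of the grid. *)
Definition valid_cells : {set {ffun 'I_n -> 'I_m.+1} * {set 'I_n}} :=
  finset (fun e : ({ffun 'I_n -> 'I_m.+1} * {set 'I_n})%type =>
    [forall i : 'I_n, (i \in e.2) ==> (e.1 i < m)%N]).

Definition cells_union (s : {set {ffun 'I_n -> 'I_m.+1} * {set 'I_n}}) :
  set (R_omega R) := \bigcup_(e in [set` s]) cell e.

Lemma closed_R_omega_coord i (S : set R) : closed S ->
  closed [set y : R_omega R | S (y i)].
Proof.
move=> cS; apply: (@closed_comp _ _ (fun y : R_omega R => y i) S) => // y _.
exact: R_omega_proj_continuous.
Qed.

Lemma closed_cell e : closed (cell e).
Proof.
have -> : cell e = \bigcap_(i in [set: 'I_n])
    [set y : R_omega R | (if i \in e.2 then [set r | pt (e.1 i) <= r <= pt (e.1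
      i).+1]
       else [set r | r = pt (e.1 i)]) (y i)] `&`
    \bigcap_(i in [set i | (n <= i)%N]) [set y : R_omega R | [set r | r = 0] (y
      i)].
  apply/seteqP; split => y [y1 y2]; split => // i.
    by move=> _; have /= := y1 i; case: ifP => // _ /eqP.
  by have /= := y1 i I; case: ifP => //= _ ->.
apply: closedI; apply: closed_bigI => i _.
  apply: closed_R_omega_coord; case: ifP => _; last exact: closed_eq.
  rewrite (_ : mkset _ = [set r | pt (e.1 i) <= r] `&` [set r | r <= pt (e.1
    i).+1]).
    by apply: closedI; [exact: closed_ge|exact: closed_le].
  by apply/seteqP; split => r /=; [move/andP|move=> ?; exact/andP].
by apply: closed_R_omega_coord; exact: closed_eq.
Qed.

Lemma closed_cells_union s : closed (cells_union s).
Proof.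
by apply: closed_bigcup => [|e _]; [exact: finite_finset|exact: closed_cell].
Qed.

(** Freezing a free coordinate in which [y] is at an end of its interval gives a face of lower
    dimension; validity of [e] keeps the upper end within the grid. *)
Lemma cell_boundary_lower e y : e \in valid_cells -> cell_boundary e y ->
  exists c, [/\ c \in valid_cells, (#|c.2| < #|e.2|)%N & cell c y].
Proof.
rewrite inE => /forall_inP ve [[ye y0] [i ie yi]].
pose k : 'I_m.+1 := if y i == pt (e.1 i) then e.1 i else inord (e.1 i).+1.
have yik : y i = pt k.
  rewrite /k; case: eqP yi => //= _ /eqP ->.
  by rewrite inordK // ltnS ve.
exists ([ffun j => if j == i then k else e.1 j], e.2 :\ i); split.
- rewrite inE; apply/forall_inP => j /=; rewrite !inE ffunE => /andP[ji je].
  by rewrite (negPf ji) ve.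
- by rewrite [X in (_ < X)%N](cardsD1 i) ie.
- split=> //= j; rewrite !inE !ffunE; case: (eqVneq j i) => [->|ji] /=.
    by rewrite yik.
  exact: ye.
Qed.

(** In a free direction of [e], [y] lies strictly between consecutive grid points, so [c] is free
    there with the same lower end. In the other directions all points of [cell e] agree. *)
Lemma cell_sub e c y : cell e y -> ~ cell_boundary e y -> cell c y ->
  cell e `<=` cell c.
Proof.
move=> ey nby [cy _] z [ze z0]; split => // i.
have [ye _] := ey; have := ye i; have := cy i; have := ze i.
have [ie|ie] := boolP (i \in e.2); last first.
  by move=> /eqP -> + /eqP <-.
move=> zi + /andP[y1 y2].
have {}y1 : pt (e.1 i) < y i.
  rewrite lt_neqAle y1 andbT eq_sym; apply/negP => yi; apply: nby; split => //.
  by exists i => //; rewrite yi.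
have {}y2 : y i < pt (e.1 i).+1.
  rewrite lt_neqAle y2 andbT; apply/negP => yi; apply: nby; split => //.
  by exists i => //; rewrite yi orbT.
case: ifPn => ic.
  move=> /andP[c1 c2].
  have := lt_le_trans y1 c2; have := le_lt_trans c1 y2; rewrite !pt_lt !ltnS.
  by move=> h1 h2; have -> : c.1 i = e.1 i by apply/val_inj/eqP;
    rewrite eqn_leq h1.
move=> /eqP yc; move: y1 y2; rewrite yc !pt_lt ltnS => h1 h2.
by have := leq_trans h1 h2; rewrite ltnn.
Qed.

Lemma cell_close e y z (i : nat) : cell e y -> cell e z -> `|y i - z i| <= d.
Proof.
move=> [ye y0] [ze z0]; case: (ltnP i n) => [il|ni]; last first.
  by rewrite y0 // z0 // subrr normr0 ltW.
have := ye (Ordinal il); have := ze (Ordinal il).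
case: ifP => _ /=; last by move=> /eqP -> /eqP ->; rewrite subrr normr0 ltW.
rewrite /pt -natr1 mulrDr mulr1 => /andP[z1 z2] /andP[y1 y2].
rewrite ler_norml; apply/andP; split; lra.
Qed.

Lemma mem_valid_cells_union (y : R_omega R) :
  (forall i, (i < n)%N -> a <= y i <= pt m) -> (0 < m)%N ->
  (forall i, (n <= i)%N -> y i = 0) -> cells_union valid_cells y.
Proof.
move=> yb m0 y0.
have /choice[k kP] (i : 'I_n) : exists k : 'I_m.+1, (k < m)%N /\
    pt k <= y i <= pt k.+1.
  have /andP[ya ym] := yb i (ltn_ord i).
  (* The least such [k] is wanted: minimality gives the lower bound [pt k <= y i]. *)
  have : exists k, (y i <= pt k.+1) && (k < m)%N by exists m.-1;
    rewrite prednK // ym /=.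
  move=> /ex_minnP[k /andP[yk km] kmin].
  have km' : (k < m.+1)%N by rewrite ltnW.
  exists (Ordinal km'); split => //=; rewrite yk andbT.
  case: k => [|k] in yk km kmin km' *; first by rewrite /pt mulr0 addr0.
  rewrite leNgt; apply/negP => /ltW yk'.
  by have := kmin k; rewrite yk' (ltnW km) ltnn => /(_ isT).
exists ([ffun i => k i], finset (fun=> true)).
  by rewrite /= inE; apply/forall_inP => i _ /=; rewrite ffunE; case: (kP i).
by split => // i; rewrite inE ffunE; case: (kP i).
Qed.

End cells.

(** * Extension over the cells of a grid *)

Lemma norm2_coord_le (R : realType) n (v : 'rV[R]_n) j :
  `|v ord0 j| <= norm2 v.
Proof.
rewrite -(@ler_pXn2r _ 2) ?nnegrE ?norm2_ge0 // norm2_sqr real_normK ?num_real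
  //.
by rewrite (bigD1 j) //= lerDl; apply: sumr_ge0 => i _; exact: sqr_ge0.
Qed.

Section cell_extension.
Context {R : realType} {n m : nat} (a d : R) (d_gt0 : 0 < d).
Context {X : topologicalType} (htX : homotopically_trivial R X).
Implicit Types (e : ({ffun 'I_n -> 'I_m.+1} * {set 'I_n})%type)
  (f : R_omega R -> X).

(* The pair (cell, boundary) is mapped to (disk, sphere) by [beta]; [alpha] maps
   the sphere back to the boundary and inverts [beta] there, so a map [f] on the
   boundary extends as [F \o beta], where [F] extends [f \o alpha]. *)
Lemma cell_extension e f : {within cell_boundary a d e, continuous f} ->
  exists g : R_omega R -> X, {within cell a d e, continuous g} /\
    forall y, cell_boundary a d e y -> g y = f y.
Proof.
(* A vertex has empty boundary, so any constant map will do. *)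
move=> cf; have [D0|[i0 i0D]] := set_0Vmem e.2.
  have [[x0 _] _] := htX; exists (fun=> x0); split; first by move=> y;
    exact: cvg_cst.
  by move=> y [_ [i]]; rewrite D0 inE.
pose D := enum e.2.
have [p Dp] : exists p, size D = p.+1.
  by exists (size D).-1; rewrite prednK // -cardE; apply/card_gt0P; exists i0.
pose vl (j : 'I_p.+1) : 'I_n := nth i0 D j.
pose idx i : 'I_p.+1 := inord (index i D).
have vlD j : vl j \in e.2 by rewrite -mem_enum mem_nth // Dp.
have idxK i : i \in e.2 -> vl (idx i) = i.
  move=> ie; rewrite /vl /idx inordK; first by rewrite nth_index // mem_enum.
  by rewrite -Dp index_mem mem_enum.
have vlK j : idx (vl j) = j.
  by rewrite /idx /vl index_uniq ?inord_val ?enum_uniq // Dp.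
pose c i : R := a + d * (e.1 i)%:R + d / 2.
(* [w] rescales the cell to the cube of half-side 1, and [beta] pushes the part of the cube outside
   the Euclidean disk radially onto the sphere. In [alpha] the division by the sup norm projects the
   sphere back onto the boundary of the cube. *)
pose w (y : R_omega R) : 'rV[R]_p.+1 := \row_j ((y (vl j) - c (vl j)) * (2 /
  d)).
pose beta y := (Num.max 1 (norm2 (w y)))^-1 *: w y.
pose alpha (v : 'rV[R]_p.+1) : R_omega R := fun i =>
  if insub i is Some i' then
    if i' \in e.2 then c i' + d / 2 * (v ord0 (idx i') / `|v|)
    else a + d * (e.1 i')%:R
  else 0.
have side (u t : R) : `|t| <= 1 -> u <= u + d / 2 + d / 2 * t <= u + d.
  rewrite ler_norml => /andP[t1 t2].
  have h1 : 0 <= d * (1 + t) by apply: mulr_ge0; [exact: ltW|lra].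
  have h2 : 0 <= d * (1 - t) by apply: mulr_ge0; [exact: ltW|lra].
  by apply/andP; split; lra.
have d20 : 0 < d / 2 by rewrite divr_gt0.
have max0 y : 0 < Num.max 1 (norm2 (w y)) by rewrite lt_max ltr01.
have wE y j : d / 2 * w y ord0 j = y (vl j) - c (vl j).
  by rewrite mxE mulrCA [d / 2 * _]mulrA divfK // divff ?mulr1 // gt_eqF.
have w_le1 y j : cell a d e y -> `|w y ord0 j| <= 1.
  move=> [ye _]; have := ye (vl j);
    rewrite vlD -natr1 mulrDr mulr1 => /andP[y1 y2].
  rewrite -(ler_pM2l d20) mulr1 -{1}(gtr0_norm d20) -normrM wE /c.
  by rewrite ler_norml; apply/andP; split; lra.
have w_max y : cell_boundary a d e y -> mx_norm (w y) = 1.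
  move=> [cy [i ie yi]]; apply/eqP; rewrite eq_le; apply/andP; split.
    have [->|/mx_norm_neq0[ij ->]] := eqVneq (mx_norm (w y)) 0;
      first exact: ler01.
    by rewrite (ord1 ij.1); exact: w_le1.
  apply: le_trans (mx_norm_coord_le _ (idx i)).
  rewrite -(ler_pM2l d20) mulr1 -{2}(gtr0_norm d20) -normrM wE /c idxK //.
  move: yi; rewrite -[(e.1 i).+1%:R]natr1 mulrDr mulr1 => /orP[/eqP ->|/eqP ->].
    by rewrite ler_normr; apply/orP; right; lra.
  by rewrite ler_normr; apply/orP; left; lra.
have w_norm2 y : cell_boundary a d e y -> 1 <= norm2 (w y).
  move=> yb; rewrite -(w_max _ yb).
  have [->|/mx_norm_neq0[ij ->]] := eqVneq (mx_norm (w y)) 0;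
    first exact: norm2_ge0.
  by rewrite (ord1 ij.1); exact: norm2_coord_le.
have norm2_beta y : norm2 (beta y) = norm2 (w y) / Num.max 1 (norm2 (w y)).
  by rewrite norm2Z ?invr_ge0 ?(ltW (max0 y)) // mulrC.
have beta_disk y : disk R p.+1 (beta y).
  by apply/disk_norm2; rewrite norm2_beta ler_pdivrMr // mul1r le_max lexx orbT.
have beta_sphere y : cell_boundary a d e y -> sphere R p (beta y).
  move=> /w_norm2 wy; apply/sphere_norm2; rewrite norm2_beta max_r //.
  by rewrite divff // gt_eqF // (lt_le_trans ltr01).
have beta_continuous : continuous beta.
  have cw : continuous w.
    apply: continuous_mx => i j; rewrite /w; under eq_fun do rewrite mxE.
    apply: continuous_mulr; last exact: continuous_cstr.
    apply: continuous_subr; last exact: continuous_cstr.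
    exact: R_omega_proj_continuous.
  apply: continuous_mx => i j; rewrite /beta; under eq_fun do rewrite mxE mulrC.
  apply: continuous_divr => [y||y]; last by rewrite gt_eqF.
    apply: (@continuous_comp _ _ _ w (fun v : 'rV[R]_p.+1 => v i j));
      first exact: cw.
    exact: coord_continuous.
  apply: continuous_maxr; first exact: continuous_cstr.
  move=> y; apply: (@continuous_comp _ _ _ w); first exact: cw.
  exact: norm2_continuous.
have sphere_neq0 v : sphere R p v -> v != 0.
  move=> /sphere_norm2 v1; apply/eqP => v0; move: v1; rewrite v0.
  rewrite /norm2 big1 ?sqrtr0 => [/eqP|i _]; first by rewrite eq_sym oner_eq0.
  by rewrite mxE expr0n.
have alpha_boundary v : sphere R p v -> cell_boundary a d e (alpha v).
  move=> /sphere_neq0 v0; have M0 : 0 < `|v| by rewrite normr_gt0.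
  have alphaE (i : 'I_n) : alpha v i = if i \in e.2
      then c i + d / 2 * (v ord0 (idx i) / `|v|) else a + d * (e.1 i)%:R.
    by rewrite /alpha valK.
  split.
    split=> [i|i ni]; last by rewrite /alpha insubF // ltnNge ni.
    rewrite alphaE; case: (boolP (i \in e.2)) => // ie.
    have : `|v ord0 (idx i) / `|v| | <= 1.
      rewrite normrM normfV normr_id ler_pdivrMr // mul1r.
      exact: mx_norm_coord_le.
    rewrite -[(e.1 i).+1%:R]natr1 [d * (_ + 1)]mulrDr mulr1 /c [a + (_ +
      d)]addrA.
    exact: side.
  have : mx_norm v != 0 by rewrite -[mx_norm v]/(`|v|) gt_eqF.
  move=> /mx_norm_neq0[[j1 j]]; rewrite (ord1 j1) -[mx_norm v]/(`|v|) /= => vj.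
  exists (vl j) => //; rewrite alphaE vlD vlK -[(e.1 _).+1%:R]natr1 [d * (_ +
    1)]mulrDr mulr1 /c vj.
  have vj0 : v ord0 j != 0 by rewrite -normr_eq0 -vj gt_eqF.
  case: (ltP 0 (v ord0 j)) => vj'.
    rewrite (gtr0_norm vj') divff // mulr1; apply/orP; right; apply/eqP; lra.
  rewrite ler0_norm // invrN mulrN divff // mulrN1; apply/orP; left;
    apply/eqP; lra.
have alpha_beta y : cell_boundary a d e y -> alpha (beta y) = y.
  move=> yb; have [[ye y0] _] := yb; apply/funext => i; rewrite /alpha.
  case: insubP => [i' _ ii'|]; last by rewrite -leqNgt => /y0 ->.
  have := ye i'; rewrite ii'; case: ifP => [i'e _|_ /eqP -> //].
  have -> : beta y ord0 (idx i') / `|beta y| = w y ord0 (idx i').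
    rewrite {2}/beta normrZ [`|w y|](w_max _ yb) mulr1 gtr0_norm ?invr_gt0 //.
    by rewrite invrK mxE mulrC mulrA divff ?mul1r // gt_eqF.
  by rewrite wE idxK // ii' addrC subrK.
have alpha_continuous : {within sphere R p, continuous alpha}.
  apply: continuous_in_subspaceT => v /set_mem/sphere_neq0 v0.
  apply: (@cvg_R_omega _ _ _ (nbhs_filter (v : 'rV[R]_p.+1))) => i;
    rewrite /alpha; case: insub => [i'|]; last exact: cvg_cst.
  case: ifP => _; last exact: cvg_cst.
  apply: cvgD; first exact: cvg_cst.
  apply: cvgM; first exact: cvg_cst.
  apply: cvgM; first exact: coord_continuous.
  apply: cvgV; first by rewrite normr_eq0.
  exact: norm_continuous.
have [|F [cF Ff]] := @homotopically_trivial_within R X p (f \o alpha) htX.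
  by apply: (within_comp (B := cell_boundary a d e)) => // v;
    exact: alpha_boundary.
exists (F \o beta); split.
  apply: (@within_comp _ _ _ (cell a d e) (disk R p.+1) beta F) => //.
  exact: continuous_subspaceT.
by move=> y yb; rewrite /= Ff /= ?alpha_beta //; exact: beta_sphere.
Qed.

(** Induction on the number of missing cells, adding one of least dimension: its boundary is covered
    by valid cells of lower dimension, which are therefore already in [s]. *)
Lemma cells_union_extension (s : {set {ffun 'I_n -> 'I_m.+1} * {set 'I_n}}) f :
  {within cells_union a d s, continuous f} ->
  exists g : R_omega R -> X,
    {within cells_union a d (@valid_cells n m), continuous g} /\
    forall y, cells_union a d s y -> g y = f y.
Proof.
have [N] := ubnP #|finset.setD (@valid_cells n m) s|.
elim: N => // N IH in s f *; rewrite ltnS => sN cf.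
have [|[e0 e0V]] := set_0Vmem (finset.setD (@valid_cells n m) s).
  move=> /eqP; rewrite finset.setD_eq0 => /fintype.subsetP Vs; exists f;
    split => //.
  apply: continuous_subspaceW cf => y [e eV ey]; exists e => //=; exact: Vs.
have [e eV emin] := @arg_minnP _ e0 (mem (finset.setD (@valid_cells n m) s))
  (fun e => #|e.2|) e0V.
have : e \in finset.setD (@valid_cells n m) s by exact: eV.
rewrite finset.in_setD => /andP[es {}eV].
have bs y : cell_boundary a d e y -> cells_union a d s y.
  move=> /(cell_boundary_lower eV)[c [cV ce cy]]; exists c => //=.
  apply: contraT => cs; move: ce; rewrite ltnNge emin //=.
  by rewrite inE cs cV.
pose s' := finset.setU [set e]%SET s.
have s'E : cells_union a d s' = cells_union a d s `|` cell a d e.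
  apply/seteqP; split => y.
    by move=> [c /=]; rewrite !inE => /orP[/eqP ->|cs] cy; [right|left;
      exists c].
  move=> [[c /= cs cy]|ey]; first by exists c; rewrite //= !inE cs orbT.
  by exists e; rewrite //= !inE eqxx.
have s'N : (#|finset.setD (@valid_cells n m) s'| < N)%N.
  apply: leq_trans sN; apply: proper_card; apply/properP; split.
    by apply/fintype.subsetP => c; rewrite !inE negb_or => /andP[/andP[_ ->]].
  by exists e; rewrite !inE ?es // ?eqxx //; move: eV; rewrite inE.
have [f' [cf' f'f]] : exists f' : R_omega R -> X,
    {within cells_union a d s', continuous f'} /\
    forall y, cells_union a d s y -> f' y = f y.
  have [sub|nsub] := pselect (cell a d e `<=` cells_union a d s).
    by exists f; split => //; rewrite s'E (setUidl sub).
  (* By [cell_sub], a cell not yet covered meets the union only in its boundary, so [f] and its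
     extension [g] over the cell agree on the overlap. *)
  have cap y : cells_union a d s y -> cell a d e y -> cell_boundary a d e y.
    move=> [c cs cy] ey; apply: contrapT => nb; apply: nsub => z ez.
    by exists c => //; exact: (cell_sub d_gt0 ey nb cy).
  have [|g [cg gf]] := @cell_extension e f.
    by apply: continuous_subspaceW cf => y; exact: bs.
  exists (fun y => if pselect (cells_union a d s y) then f y else g y).
  split; last by move=> y sy; case: pselect.
  rewrite s'E; apply: withinU_continuous.
  - exact: closed_cells_union.
  - exact: closed_cell.
  - by apply: within_eq cf => y sy; case: pselect.
  - apply: within_eq cg => y ey; case: pselect => // sy.
    by apply: gf; exact: cap.
have [g [cg gf']] := IH _ _ s'N cf'.
exists g; split => // y sy; rewrite gf'; first exact: f'f.
by rewrite s'E; left.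
Qed.

End cell_extension.

(** * Neighbourhood retracts of the countable product of lines *)

Section clamp.
Context {R : realType}.

(** Continuous in [s], so that clamping varies continuously with the size of the box, and zero once
    [i] reaches [s], so that every box is finite-dimensional. *)
Definition radius (s : R) (i : nat) : R := Num.max 0 (s - i%:R).

(* For [s <= N] the compact set [box s] lies in the span of the first [N]
   coordinates. *)
Definition box (s : R) : set (R_omega R) :=
  [set y : R_omega R | forall i, `|y i| <= radius s i].

Definition clamp (s : R) (y : R_omega R) : R_omega R :=
  fun i => Num.max (- radius s i) (Num.min (radius s i) (y i)).

Lemma radius_ge0 s i : 0 <= radius s i.
Proof. by rewrite le_max lexx. Qed.

Lemma clamp_box s y : box s (clamp s y).
Proof.
move=> i; have := radius_ge0 s i; rewrite /clamp => r0.
by rewrite ler_norml le_max lexx /= ge_max ge_min lexx /= andbT; lra.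
Qed.

Lemma clamp_id s y i : `|y i| <= radius s i -> clamp s y i = y i.
Proof. by rewrite ler_norml /clamp => /andP[y1 y2]; rewrite min_r // max_r. Qed.

Lemma box_clamp s y : box s y -> clamp s y = y.
Proof. by move=> ys; apply/funext => i; rewrite clamp_id. Qed.

Lemma box_le s t : s <= t -> box s `<=` box t.
Proof.
move=> st y ys i; apply: le_trans (ys i) _.
by rewrite ge_max !le_max lexx /= lerD2r st orbT.
Qed.

Lemma box_nat_eq0 (N : nat) y i : box N%:R y -> (N <= i)%N -> y i = 0.
Proof.
move=> /(_ i) + Ni; rewrite /radius max_l ?subr_le0 ?ler_nat //.
by rewrite normr_le0 => /eqP.
Qed.

Lemma closed_box s : closed (box s).
Proof.
rewrite (_ : box s = \bigcap_i [set y : R_omega R | `|y i| <= radius s i]).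
  apply: closed_bigI => i _.
  apply: (@closed_R_omega_coord R i [set r | `|r| <= radius s i]).
  apply: (@closed_comp _ _ (fun r : R => `|r|) [set r | r <= radius s i]).
    by move=> r _; exact: norm_continuous.
  exact: closed_le.
by apply/seteqP; split => y ys i; [move=> _|]; exact: ys.
Qed.

Lemma compact_box s : compact (box s).
Proof.
rewrite (_ : box s =
    [set y : R_omega R | forall i, `[- radius s i, radius s i]%classic (y i)]).
  apply: (@tychonoff nat (fun=> R) (fun i => `[- radius s i, radius s
    i]%classic)).
  by move=> i; exact: segment_compact.
apply/seteqP; split => y ys i; have := ys i.
  by rewrite /= in_itv /= ler_norml.
by rewrite /= in_itv /= ler_norml.
Qed.

(** Stated at a point because it is applied with [s] an inverse distance to [X], whose continuity is
    available off [X]. *)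
Lemma clamp_continuous (T : topologicalType) (x : T) (s : T -> R)
    (k : T -> R_omega R) : {for x, continuous s} -> {for x, continuous k} ->
  {for x, continuous (fun z => clamp (s z) (k z))}.
Proof.
move=> cs ck; apply: (@cvg_R_omega _ _ _ (nbhs_filter x)) => i.
have cr : {for x, continuous (fun z => radius (s z) i)}.
  apply: (@continuous_max R T (fun=> 0) (fun z => s z - i%:R)).
    exact: cvg_cst.
  by apply: cvgB; [exact: cs|exact: cvg_cst].
apply: (@continuous_max R T (fun z => - radius (s z) i)
    (fun z => Num.min (radius (s z) i) (k z i))).
  by apply: cvgN; exact: cr.
apply: (@continuous_min R T (fun z => radius (s z) i) (fun z => k z i)) => //.
apply: (@continuous_comp _ _ _ k (fun y : R_omega R => y i)) => //.
exact: R_omega_proj_continuous.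
Qed.

Lemma clamp_cst_continuous s : continuous (clamp s).
Proof.
apply: continuous_R_omega => i; rewrite /clamp.
apply: continuous_maxr; first exact: continuous_cstr.
move=> y; apply: (@continuous_min R (R_omega R) (fun=> radius s i) (fun z => z
  i)).
  exact: continuous_cstr.
exact: R_omega_proj_continuous.
Qed.

End clamp.

Section neighbourhood_retract.
Context {R : realType} {X : topologicalType} (e : X -> R_omega R).
Hypothesis cee : closed_embedding e.
Hypothesis htX : homotopically_trivial R X.
Variables (O : set (R_omega R)) (rho : R_omega R -> X).
Hypotheses (oO : open O) (eO : range e `<=` O).
Hypotheses (crho : {in O, continuous rho}) (rhoK : cancel e rho).

(** Extend [e \o f] to a map [F] into [R_omega] by Tietze's theorem, and compose with [rho] on the
    preimage of [O] under [F]. *)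
Lemma neighbourhood_extension (K : set (R_omega R)) (f : R_omega R -> X) :
  closed K -> {within K, continuous f} ->
  exists (W : set (R_omega R)) (g : R_omega R -> X),
    [/\ open W, K `<=` W, {in W, continuous g} & forall y, K y -> g y = f y].
Proof.
move=> cK cf; have ce := closed_embedding_continuous cee.
have PK := closed_embedding_left_orth (metrisable_R_omega R)
  (closed_embedding_set_val cK).
have cef : continuous (sigL K (e \o f)).
  apply/subspace_sigL_continuousP => y.
  apply: (@continuous_comp (subspace K) X _ f e); [exact: cf|exact: ce].
have [F [cF Fe]] := left_orth_R_omega PK cef.
have FK y : K y -> F y = e (f y).
  by move=> Ky; have := congr1 (@^~ (exist _ y (mem_set Ky) : K)) Fe.
exists (F @^-1` O), (rho \o F); split.
- by move/continuousP : cF; exact.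
- by move=> y Ky; rewrite /preimage /= FK //; apply: eO; exists (f y).
- move=> y /set_mem Fy; apply: continuous_comp; first exact: cF.
  by apply: crho; rewrite inE.
- by move=> y Ky /=; rewrite FK // rhoK.
Qed.

(** A Lebesgue number argument, with compactness in its near-covering form. *)
Lemma mesh_exists (N : nat) (K W : set (R_omega R)) (L : R) : 0 < L ->
  compact K -> open W -> K `<=` W ->
  exists m : nat, forall y z : R_omega R, K y ->
    (forall i, `|y i - z i| <= L / m.+1%:R) -> W z.
Proof.
move=> L0 /compact_near_coveringP cK oW KW.
pose P (m : nat) (y : R_omega R) := forall z : R_omega R,
  (forall i, `|y i - z i| <= L / m.+1%:R) -> W z.
have [|m hm] := filter_ex (cK nat \oo P _ _); last first.
  by exists m => y z /hm; exact.
move=> x /KW Wx.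
have /nbhs_R_omega[n [d [d0 dW]]] : nbhs x W by exact: open_nbhs_nbhs.
have d20 : 0 < d / 2 by rewrite divr_gt0.
exists ([set y : R_omega R | forall i : 'I_n, `|x i - y i| < d / 2],
        [set m | m.+1%:R^-1 < d / 2 / L]).
  split => /=.
    apply: (@filter_forall _ _ (fun (i : 'I_n) (y : R_omega R) => `|x i - y i|
      < d / 2)
      _ (nbhs_filter (x : R_omega R))) => i.
    have /(@cvgrPdist_lt _ R) := @R_omega_proj_continuous R i x.
    by apply; rewrite divr_gt0.
  have dL0 : 0 < d / 2 / L by rewrite divr_gt0.
  exact: (near_infty_natSinv_lt (PosNum dL0)).
move=> [y k] [/= xy km] z yz; apply: dW => i il.
apply: le_trans (ler_distD (y i) _ _) _; rewrite [d]splitr.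
apply: lerD; first exact: ltW (xy (Ordinal il)).
apply: le_trans (yz i) _; rewrite mulrC -ler_pdivlMr //; exact: ltW.
Qed.

(** After extending [f] to a neighbourhood [W] of [K], take a grid so fine that its cells meeting
    [K] lie in [W], extend from these to the whole grid, and clamp to get a map on [R_omega]. *)
Lemma box_extension (N : nat) (K : set (R_omega R)) (f : R_omega R -> X) :
  closed K -> K `<=` box N%:R -> {within K, continuous f} ->
  exists g : R_omega R -> X, continuous g /\ forall y, K y -> g y = f y.
Proof.
move=> cK KN cf; have [W [g [oW KW cg gf]]] := neighbourhood_extension cK cf.
have coK : compact K by apply: subclosed_compact KN => //; exact: compact_box.
(* The grid divides the cube of half-side N + 1 in the first N coordinates; N + 1 rather than N
   keeps the mesh positive when N = 0. *)
have L0 : 0 < N.+1%:R :> R by [].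
have [m hm] := mesh_exists N (mulr_gt0 (ltr0Sn R 1) L0) coK oW KW.
set d : R := _ / m.+1%:R in hm; pose a : R := - N.+1%:R.
have d0 : 0 < d by rewrite divr_gt0 // mulr_gt0.
have adm : a + d * m.+1%:R = N.+1%:R.
  by rewrite /d divfK ?pnatr_eq0 // /a; lra.
have boxV : box N%:R `<=` cells_union a d (@valid_cells N m.+1).
  move=> y yN; apply: mem_valid_cells_union => // [i il|i];
    last exact: box_nat_eq0.
  rewrite adm -ler_norml; apply: le_trans (yN i) _.
  rewrite ge_max ler0n /= lerBlDr (@le_trans _ _ N.+1%:R) ?ler_nat //.
  by rewrite lerDl.
pose s := finset (fun c : ({ffun 'I_N -> 'I_m.+2} * {set 'I_N})%type =>
  (c \in @valid_cells N m.+1) && `[<exists2 y, K y & cell a d c y>]).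
have Ks : K `<=` cells_union a d s.
  move=> y Ky; have [c /= cV cy] := boxV _ (KN _ Ky).
  by exists c => //=; rewrite inE cV /=; apply/asboolP; exists y.
have sW : cells_union a d s `<=` W.
  move=> z [c /=]; rewrite inE => /andP[_ /asboolP[y Ky cy]] cz.
  by apply: (hm y) => // i; exact: cell_close cy cz.
have [|h [ch hg]] := @cells_union_extension R N m.+1 a d d0 X htX s g.
  by apply: continuous_in_subspaceT => y /set_mem/sW Wy; apply: cg; rewrite inE.
exists (h \o clamp N%:R); split.
  apply/continuous_subspace_setT.
  apply: (within_comp (B := cells_union a d (@valid_cells N m.+1))) => //.
    by move=> y _; apply: boxV; exact: clamp_box.
  apply: continuous_subspaceT.
  exact: clamp_cst_continuous.
move=> y Ky; rewrite /= box_clamp ?hg ?gf //; first exact: Ks.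
exact: KN.
Qed.

(** Each map extends the union of [rho] on [C] within the next box and the previous map on its own
    box; the two agree on the overlap by the invariant [good]. *)
Lemma telescope_exists (C : set (R_omega R)) : closed C -> C `<=` O ->
  exists G : nat -> R_omega R -> X,
    [/\ forall N, continuous (G N),
        forall N y, C y -> box N%:R y -> G N y = rho y &
        forall N M y, (N <= M)%N -> box N%:R y -> G M y = G N y].
Proof.
move=> cC CO.
have crhoC : {within C, continuous rho}.
  by apply: continuous_in_subspaceT => y /set_mem/CO Oy; apply: crho;
    rewrite inE.
pose good N (g : R_omega R -> X) := continuous g /\
  forall y, C y -> box N%:R y -> g y = rho y.
have [g0 [cg0 g0rho]] : exists g, good 0 g.
  have [|||g [cg gr]] := @box_extension 0 (C `&` box 0%:R) rho.
  - by apply: closedI => //; exact: closed_box.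
  - by move=> y [].
  - by apply: continuous_subspaceW crhoC => y [].
  by exists g; split => // y Cy y0; apply: gr.
(* The choice ranges over all pairs, good or not, so that [st] is a total successor function which
   [fix] can iterate. *)
have /choice[st stP] (p : nat * (R_omega R -> X)) : exists g', good p.1 p.2 ->
    good p.1.+1 g' /\ forall y, box p.1%:R y -> g' y = p.2 y.
  case: p => N g /=; have [[cg gr]|ng] := pselect (good N g); last by exists g.
  pose f y := if pselect (box N%:R y) then g y else rho y.
  have fg y : box N%:R y -> f y = g y by move=> yN; rewrite /f; case: pselect.
  have frho y : C y -> f y = rho y.
    by move=> Cy; rewrite /f; case: pselect => // yN; exact: gr.
  have [|||g' [cg' g'f]] := @box_extension N.+1 ((C `&` box N.+1%:R) `|` box
    N%:R) f.
  - by apply: closedU; [apply: closedI => //|]; exact: closed_box.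
  - move=> y [[]//|]; apply: box_le; by rewrite ler_nat.
  - apply: withinU_continuous.
    + by apply: closedI => //; exact: closed_box.
    + exact: closed_box.
    + apply: (@within_eq _ _ _ rho) => [y [Cy _]|]; first by rewrite frho.
      by apply: continuous_subspaceW crhoC => y [].
    + apply: (@within_eq _ _ _ g) => [y yN|]; first by rewrite fg.
      exact: continuous_subspaceT.
  exists g' => _; split; last by move=> y yN; rewrite g'f ?fg //; right.
  by split => // y Cy yN; rewrite g'f ?frho //; left.
pose G := fix G N := if N is N'.+1 then st (N', G N') else g0.
have Ggood N : good N (G N).
  by elim: N => [|N IH]; [split|have [] := stP (N, G N) IH].
have GS N y : box N%:R y -> G N.+1 y = G N y.
  by have [_] := stP (N, G N) (Ggood N); exact.
exists G; split; [by move=> N; case: (Ggood N)|by move=> N; case: (Ggood N)|].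
move=> N M y NM yN; rewrite -(subnKC NM); elim: (M - N)%N => [|k IH].
  by rewrite addn0.
rewrite addnS GS ?IH //; apply: box_le yN; by rewrite ler_nat leq_addr.
Qed.

End neighbourhood_retract.

(** * Retraction onto a homotopically trivial neighbourhood retract *)

Section retraction_of_R_omega.
Context {R : realType} {X : topologicalType} (e : X -> R_omega R).
Hypothesis cee : closed_embedding e.
Hypothesis htX : homotopically_trivial R X.
Variables (O : set (R_omega R)) (rho : R_omega R -> X).
Hypotheses (oO : open O) (eO : range e `<=` O).
Hypotheses (crho : {in O, continuous rho}) (rhoK : cancel e rho).

(** The distance from [y] to [X], an infimum written as minus a supremum so that [lipschitz_sup]
    applies. *)
Let dist_range (y : R_omega R) : R :=
  - sup (range (fun x => - seq_dist y (e x))).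

Let dist_ub y : has_ubound (range (fun x => - seq_dist y (e x))).
Proof. by exists 0 => _ [x _ <-]; rewrite oppr_le0;
  exact: (@mdist_ge0 R (seq_space R)). Qed.

Let dist_range_continuous : continuous dist_range.
Proof.
have [[x0 _] _] := htX.
have csup : continuous (fun y : seq_space R => sup (range (fun x => - mdist y
  (e x)))).
  apply: lipschitz_continuous => y z.
  apply: (@lipschitz_sup R (seq_space R) X (fun x y => - mdist y (e x))) => //
    x y' z'.
  rewrite lerNl opprD opprK lerBlDr addrC.
  by rewrite [mdist y' z']metric_sym; exact: metric_triangle.
apply: continuous_oppr => y.
exact: (continuous_comp (@R_omega_seq_space_continuous R y) (csup y)).
Qed.

Let dist_range_le x y : dist_range y <= seq_dist y (e x).
Proof. by rewrite lerNl; apply: ub_le_sup; [exact: dist_ub|exists x]. Qed.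

Let dist_range_gt0 y : ~ range e y -> 0 < dist_range y.
Proof.
move=> ny; have [[x0 _] _] := htX; have [_ _ eC] := cee.
have : nbhs y (~` range e) by apply: open_nbhs_nbhs; split => //;
  exact: closed_openC.
move=> /(@seq_space_R_omega_continuous R).
rewrite -[X in X _ -> _]/(nbhs (y : seq_space R)) -filter_from_ballE.
move=> [r /= r0 yr]; apply: lt_le_trans r0 _.
rewrite lerNr; apply: ge_sup; first by exists (- seq_dist y (e x0)), x0.
move=> _ [x _ <-]; rewrite lerN2 leNgt; apply/negP => xy.
by apply: (yr (e x)); [rewrite ballEmdist|exists x].
Qed.

(* [G] on [box N] is total but agrees with [rho] only on the closed
   neighbourhood [~` V] of [X]; the radius [s] tends to infinity near [X], so
   that [clamp (s y) y] tends to [x] as [y] tends to [x] in [X] and eventually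
   lies where [G] is [rho]. *)
Lemma homotopically_trivial_retraction :
  exists r : R_omega R -> X, continuous r /\ cancel e r.
Proof.
have [eI eo eC] := cee.
(* The complement of [V] is a closed set inside [O] that contains the open neighbourhood [U] of
   [range e]. *)
have [||||||U [V [oU oV eU OV UV]]] := @metrisable_separated R (R_omega R)
  (range e) (~` O) O (~` range e) (metrisable_R_omega R).
- exact: oO.
- exact: closed_openC.
- exact: eO.
- by move=> y nOy /eO.
- exact: setICr.
- exact: setICl.
have UC : U `<=` ~` V by move=> y Uy Vy; have : (U `&` V) y by []; rewrite UV.
have CO : ~` V `<=` O by move=> y nVy; apply: contrapT => /OV.
have [G [cG Grho GS]] := telescope_exists cee htX oO eO crho rhoK (open_closedC
  oV) CO.
pose s y := (dist_range y)^-1.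
pose N y := (Num.truncn (s y)).+1.
have sN y : s y <= (N y)%:R by exact: ltW (truncnS_gt _).
have clampN y : box (N y)%:R (clamp (s y) y).
  by apply: (box_le (sN y)); exact: clamp_box.
pose r y := if pselect (range e y) then rho y else G (N y) (clamp (s y) y).
have rX y : range e y -> r y = rho y by move=> ey; rewrite /r; case: pselect.
have rN y : ~ range e y -> r y = G (N y) (clamp (s y) y).
  by move=> ey; rewrite /r; case: pselect.
exists r; split; last by move=> x; rewrite rX ?rhoK //; exists x.
move=> y; have [[x _ xy]|ny] := pselect (range e y).
  move=> W; rewrite rX; last by exists x.
  have Oy : y \in O by rewrite inE; apply: eO; exists x.
  move=> /(crho Oy) Wy.
  have : nbhs y (U `&` rho @^-1` W).
    apply: filterI => //; apply: open_nbhs_nbhs; split => //.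
    by apply: eU; exists x.
  move=> /nbhs_R_omega[n [d [d0 dUW]]].
  (* If [B < s z], then for [i < n] the radius exceeds [|y i| + 1], which bounds [|z i|]. Hence
     clamping leaves the first [n] coordinates of [z] unchanged. *)
  pose B : R := n%:R + \sum_(i < n) `|y i| + 1.
  have B0 : 0 < B.
    by rewrite /B ltr_wpDl // addr_ge0 //; apply: sumr_ge0.
  have nearB : nbhs y [set z : R_omega R | dist_range z < B^-1].
    apply: open_nbhs_nbhs; split; last first.
      rewrite /= -xy; apply: le_lt_trans (dist_range_le x (e x)) _.
      by rewrite -[seq_dist _ _]/(mdist (e x : seq_space R) (e x)) mdistxx
        invr_gt0.
    apply: (@open_comp _ _ dist_range [set t | t < B^-1]) => [z _|].
      exact: dist_range_continuous.
    exact: open_lt.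
  (* The bound 1 serves to get [|z i| <= |y i| + 1]. *)
  pose d' := Num.min d 1.
  have d'0 : 0 < d' by rewrite lt_min d0 ltr01.
  have nearn : nbhs y [set z : R_omega R | forall i : 'I_n, `|y i - z i| < d'].
    apply: (@filter_forall _ _ (fun (i : 'I_n) (z : R_omega R) => `|y i - z i|
      < d')
      _ (nbhs_filter (y : R_omega R))) => i.
    by have /(@cvgrPdist_lt _ R) := @R_omega_proj_continuous R i y; apply.
  apply: (@filterS2 _ _ (nbhs_filter (y : R_omega R)) _ _ _ _ nearB nearn).
  move=> z /= zB zn.
  have zd i : (i < n)%N -> `|y i - z i| <= d.
    move=> il; apply: le_trans (ltW (zn (Ordinal il))) _.
    by rewrite ge_min lexx.
  have [ez|nez] := pselect (range e z).
    by rewrite /preimage /= rX //; case: (dUW z zd).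
  rewrite /preimage /= rN //.
  have sB : B < s z.
    by rewrite /s -[ltLHS]invrK ltf_pV2 // posrE ?invr_gt0 // dist_range_gt0.
  have [|Uc Wc] := dUW (clamp (s z) z).
    move=> i il; rewrite clamp_id; first exact: zd.
    rewrite le_max; apply/orP; right.
    have zi1 : `|z i| <= `|y i| + 1.
      have h1 : `|y i - z i| <= 1.
        apply: le_trans (ltW (zn (Ordinal il))) _.
        by rewrite ge_min lexx orbT.
      have h2 : `|z i| <= `|y i| + `|y i - z i|.
        by rewrite -{1}[z i](subKr (y i)); apply: ler_normB.
      lra.
    have yi : `|y i| <= \sum_(i < n) `|y i|.
      by rewrite (bigD1 (Ordinal il)) //= lerDl; apply: sumr_ge0.
    have iN : i%:R <= n%:R :> R by rewrite ler_nat ltnW.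
    move: sB; rewrite /B => sB; lra.
  by rewrite Grho //; exact: UC.
have nbhs_ny : nbhs y (~` range e).
  by apply: open_nbhs_nbhs; split => //; exact: closed_openC.
have cs : {for y, continuous s}.
  apply: (@continuousV R (R_omega R) dist_range y).
    by rewrite gt_eqF // dist_range_gt0.
  exact: dist_range_continuous.
(* [N z] may jump near [y], but it stays at most [M], and there [GS] replaces [G (N z)] by the fixed
   continuous map [G M]. *)
pose M := N y.
have nearM : nbhs y [set z : R_omega R | s z < M%:R].
  apply: (cs [set t | t < M%:R]); apply: open_nbhs_nbhs; split;
    first exact: open_lt.
  exact: truncnS_gt.
have cGM : {for y, continuous (fun z => G M (clamp (s z) z))}.
  apply: (@continuous_comp _ _ _ (fun z => clamp (s z) z) (G M));
    last exact: cG.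
  apply: (@clamp_continuous R (R_omega R) y s id) => //.
move=> W; rewrite rN // => /cGM Wy.
apply: (@filterS3 _ _ (nbhs_filter (y : R_omega R)) _ _ _ _ _ nbhs_ny nearM Wy).
move=> z nez sM GW; rewrite /preimage /= rN //.
have NM : (N z <= M)%N.
  rewrite /N /M /N ltnS truncn_le_nat; exact: sM.
by rewrite -(GS _ _ _ NM).
Qed.

End retraction_of_R_omega.

(** The neighbourhood retraction lives on the subspace [U]; it is extended by a constant [x0], and
    continuity is kept on the interior of [U], which serves as [O]. *)
Lemma homotopically_trivial_neighbourhood_retract (R : realType)
    (X : topologicalType) (e : X -> R_omega R) : closed_embedding e ->
  absolute_neighbourhood_retract R X -> homotopically_trivial R X ->
  is_retract_of X (R_omega R).
Proof.
move=> cee /(_ _ e (separable_R_omega R) (metrisable_R_omega R) cee)[U eU [r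
  [cr re]]] htX.
have [[x0 _] _] := htX.
have [||||r' [cr' er']] := @homotopically_trivial_retraction R X e cee htX
  (interior U) (valL_ x0 r).
- exact: open_interior.
- exact: eU.
- have crU : {within U, continuous (valL_ x0 r)} by
    exact/subspace_valL_continuousP'.
  rewrite -continuous_open_subspace; last exact: open_interior.
  by apply: continuous_subspaceW crU; exact: interior_subset.
- move=> x; have Ux : U (e x) by apply: interior_subset; apply: eU; exists x.
  pose z : U := exist _ (e x) (mem_set Ux).
  rewrite -[LHS]/(sigL U (valL_ x0 r) z) valLK; exact: re.
by exists e, r'; split => //; exact: closed_embedding_continuous cee.
Qed.

Theorem theorem3p14 (R : realType) (X : topologicalType)
    (sepX : separable_space X) (cmX : completely_metrisable R X) :
  (right_orth (left_orth gen_maps) (to_point X) <->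
   is_retract_of X (R_omega R))
  /\
  (absolute_neighbourhood_retract R X ->
   [<-> right_orth (left_orth gen_maps) (to_point X);
        is_retract_of X (R_omega R);
        contractible R X;
        homotopically_trivial R X;
        absolute_retract R X;
        absolute_extensor R X]).
Proof.
have [e cee] := separable_completely_metrisable_closed_embedding sepX cmX.
have r12 : right_orth (left_orth gen_maps) (to_point X) -> is_retract_of X
  (R_omega R).
  by move=> /(@right_orth_absolute_retract R);
    exact: absolute_retract_retract_R_omega cee.
have r21 := @retract_R_omega_right_orth R X.
split; first by split.
(* The implications form one cycle; [anrX] enters in passing from homotopical triviality to absolute
   retracts. *)
move=> anrX; tfae.
- exact: r12.
- exact: retract_R_omega_contractible.
- exact: contractible_homotopically_trivial.
- move=> htX; apply/right_orth_absolute_retract/r21.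
  exact: homotopically_trivial_neighbourhood_retract cee anrX htX.
- move=> /(absolute_retract_retract_R_omega cee)/r21.
  exact: right_orth_absolute_extensor.
- by move=> /(absolute_extensor_retract_R_omega cee)/r21.
Qed.
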